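(* Let $n>4$. (1) There is a bijection $\phi:D(T_0)^+\to Y$ from the set $D(T_0)^+$ of geodesics in $\Gamma_n$ from $T_0$ to $T_0^R$ that start by flipping $[0,2]$ to the set $Y$ of standard tableaux of truncated shifted staircase shape $(n-3,n-3,n-4,\ldots,1)$. (2) Moreover, for this bijection $\phi$, for every geodesic $u\in D(T_0)^+$ and every $1\le i\le n(n-3)/2$, the diagonal flipped at the $i$-th step of $u$ is $$[\,r(\phi(u))_i-1,\; c(\phi(u))_i+1\,].$$
   Context: Triangulations. Label the vertices of a convex $n$-gon $P_n$ cyclically by the elements $0,1,\ldots,n-1$ of $\mathbb{Z}_n$. Triangulations of $P_n$ have no extra vertices. Edges of the polygon are external edges; all other edges of a triangulation are internal edges, or chords; $[i,j]$ denotes the segment joining vertices $i$ and $j$. A triangulation is triangle-free if it contains no triangle with three internal edges. A chord is short if it connects vertices $i-1$ and $i+1$ for some $i\in\mathbb{Z}_n$; a triangle-free triangulation contains exactly two short chords. A proper coloring of a triangle-free triangulation is a labeling of its $n-3$ chords by $0,\ldots,n-4$ (each label used once) such that one of the short chords is labeled $0$ and, whenever a triangle has exactly two internal edges, their labels are consecutive integers $i,i+1$. $CTFT(n)$ is the set of all properly colored triangle-free triangulations of $P_n$. Each chord is a diagonal of a unique quadrangle (the union of the two adjacent triangles); replacing the chord by the other diagonal of that quadrangle is a flip of the chord; in a colored triangulation the new diagonal receives the label of the flipped one. The diagonal flipped at a step is the chord that is erased and replaced at that step. The colored flip graph $\Gamma_n$ has vertex set $CTFT(n)$; two elements are joined by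 an edge if one is obtained from the other by a flip of a chord. A geodesic is a shortest path in $\Gamma_n$. For $T\in CTFT(n)$, $T^R$ is the same triangulation with the chord labeled $i$ relabeled $n-4-i$ ($0\le i\le n-4$); the distance between $T$ and $T^R$ in $\Gamma_n$ is $n(n-3)/2$. $T_0\in CTFT(n)$ is the canonical colored star triangulation consisting of the chords $[0,2],[0,3],\ldots,[0,n-2]$ labeled $0,1,\ldots,n-4$ respectively. Tableaux. The truncated shifted staircase shape $(n-3,n-3,n-4,\ldots,1)$ is the set of $n(n-3)/2$ cells (row, column) consisting of the cells $(1,c)$ with $1\le c\le n-3$, and the cells $(r,c)$ with $2\le r\le c\le n-2$ (i.e. the rows have lengths $n-3,n-3,n-4,\ldots,1$, with row $r$ starting in column $r$). A standard tableau of this shape is a bijective filling of its cells by $1,2,\ldots,n(n-3)/2$ that is increasing along rows (left to right) and down columns. For such a tableau $Q$, $r(Q)_i$ and $c(Q)_i$ denote respectively the row and the column in which the entry $i$ is located. *)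

(* Defs.v *)
From mathcomp Require Import all_boot.

Set Implicit Arguments.
Unset Strict Implicit.
Unset Printing Implicit Defensive.

(* The vertices of the convex n-gon are the elements of 'I_n in cyclic order,
   with cyclic successor ordS and predecessor ord_pred. A segment [i,j] is the
   two-element set of its endpoints. *)
Definition seg (n i j : nat) : {set 'I_n} :=
  [set x : 'I_n | (x == i :> nat) || (x == j :> nat)].

Definition external (n : nat) : {set {set 'I_n}} :=
  [set [set i; ordS i] | i : 'I_n].

Definition internal (n : nat) : {set {set 'I_n}} :=
  [set e : {set 'I_n} | (#|e| == 2) && (e \notin external n)].

Definition crossing (n : nat) (e f : {set 'I_n}) : bool :=
  [exists a : 'I_n, exists b : 'I_n, exists c : 'I_n, exists d : 'I_n,
    [&& a < b, b < c, c < d &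
      ((e == [set a; c]) && (f == [set b; d])) ||
      ((f == [set a; c]) && (e == [set b; d]))]].

Definition noncrossing (n : nat) (T : {set {set 'I_n}}) : bool :=
  (T \subset internal n) &&
  [forall e in T, forall f in T, ~~ crossing e f].

(* A triangulation without extra vertices, given by its set of chords. *)
Definition triangulation (n : nat) (T : {set {set 'I_n}}) : bool :=
  maxset (@noncrossing n) T.

Definition sides (n : nat) (t : {set 'I_n}) : {set {set 'I_n}} :=
  [set e : {set 'I_n} | (e \subset t) && (#|e| == 2)].

(* Since P_n is convex, no chord of a triangulation enters a triangle whose
   sides all belong to the triangulation: every such triangle is a face. *)
Definition triangles (n : nat) (T : {set {set 'I_n}}) : {set {set 'I_n}} :=
  [set t : {set 'I_n} | (#|t| == 3) && (sides t \subset external n :|: T)].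

Definition triangle_free (n : nat) (T : {set {set 'I_n}}) : bool :=
  [forall t in triangles T, #|sides t :&: T| != 3].

Definition short_chord (n : nat) (e : {set 'I_n}) : bool :=
  [exists i : 'I_n, e == [set ord_pred i; ordS i]].

(* A colored triangulation is stored as the map sending each label
   0, ..., n-4 to the chord carrying it. *)
Definition coloring (n : nat) := {ffun 'I_(n - 3) -> {set 'I_n}}.

Definition chords (n : nat) (C : coloring n) : {set {set 'I_n}} :=
  [set C k | k : 'I_(n - 3)].

Definition proper (n : nat) (C : coloring n) : bool :=
  [&& injectiveb C,
      [exists k : 'I_(n - 3), (k == 0 :> nat) && short_chord (C k)] &
      [forall t in triangles (chords C),
        (#|sides t :&: chords C| == 2) ==>
        [forall k : 'I_(n - 3), forall l : 'I_(n - 3),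
          [&& C k \in sides t, C l \in sides t & k < l] ==>
          (l == k.+1 :> nat)]]].

Definition CTFT (n : nat) : {set coloring n} :=
  [set C : coloring n |
    [&& triangulation (chords C), triangle_free (chords C) & proper C]].

(* C' is obtained from C by flipping the chord e: if t1 and t2 are the two
   triangles adjacent to e, then the quadrangle has vertex set t1 :|: t2 and
   its diagonal other than e is (t1 :|: t2) :\: e. *)
Definition flip (n : nat) (C : coloring n) (e : {set 'I_n}) (C' : coloring n)
    : bool :=
  [exists k : 'I_(n - 3),
   exists t1 in triangles (chords C), exists t2 in triangles (chords C),
    [&& C k == e, t1 != t2, e \in sides t1, e \in sides t2 &
        C' == [ffun l => if l == k then (t1 :|: t2) :\: e else C l]]].

(* The graph Gamma_n; its vertex set CTFT n is enforced by adjacency. *)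
Definition Gamma (n : nat) : rel (coloring n) := fun C C' =>
  [&& C \in CTFT n, C' \in CTFT n &
      [exists e : {set 'I_n}, flip C e C' || flip C' e C]].

(* As for path, the initial vertex x is not listed in p. *)
Definition geodesic (V : finType) (E : rel V) (x y : V) (p : seq V) : bool :=
  [&& path E x p, last x p == y &
      [forall m : 'I_(size p), forall q : m.-tuple V,
        ~~ (path E x q && (last x q == y))]].

Definition reversal (n : nat) (C : coloring n) : coloring n :=
  [ffun k : 'I_(n - 3) => C (rev_ord k)].

Definition star (n : nat) : coloring n :=
  [ffun k : 'I_(n - 3) => seg n 0 k.+2].

(* e is the diagonal flipped at the i-th step (i >= 1) of the path that starts
   at star n and then visits the vertices listed in u. *)
Definition flipped_at (n : nat) (u : seq (coloring n)) (i : nat)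
    (e : {set 'I_n}) : bool :=
  flip (nth (star n) (star n :: u) i.-1) e (nth (star n) (star n :: u) i).

Definition Dplus (n : nat) :=
  {u : seq (coloring n) |
    geodesic (@Gamma n) (star n) (reversal (star n)) u &&
    flipped_at u 1 (seg n 0 2)}.

(* Rows and columns are numbered from 1. *)
Definition in_shape (n r c : nat) : bool :=
  [&& r == 1, 1 <= c & c <= n - 3] || [&& 2 <= r, r <= c & c <= n - 2].

Definition cell (n : nat) :=
  {x : 'I_n * 'I_n | in_shape n x.1 x.2}.

Definition row (n : nat) (x : cell n) : nat := (val x).1.
Definition col (n : nat) (x : cell n) : nat := (val x).2.

Definition standard (n : nat) (Q : {ffun cell n -> nat}) : bool :=
  [&& perm_eq (codom Q) (iota 1 (n * (n - 3))./2),
      [forall x : cell n, forall y : cell n,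
        (row x == row y) && (col x < col y) ==> (Q x < Q y)] &
      [forall x : cell n, forall y : cell n,
        (col x == col y) && (row x < row y) ==> (Q x < Q y)]].

Definition tableau (n : nat) := {Q : {ffun cell n -> nat} | standard Q}.

(* The default value 0 is never reached for 1 <= i <= n(n-3)/2. *)
Definition row_of (n : nat) (Q : tableau n) (i : nat) : nat :=
  oapp (@row n) 0 [pick x : cell n | val Q x == i].
Definition col_of (n : nat) (Q : tableau n) (i : nat) : nat :=
  oapp (@col n) 0 [pick x : cell n | val Q x == i].

(* Main.v *)
Require Import Defs.
From mathcomp Require Import all_boot all_order ssralg ssrnum ssrint intdiv zify.

Set Implicit Arguments.
Unset Strict Implicit.
Unset Printing Implicit Defensive.

Import Order.TTheory GRing.Theory Num.Theory.

(** The dual tree of a triangle-free triangulation is a path, so the chords of a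
    properly colored one grow around the short chord labeled 0 by moving one
    endpoint outward at a time: the chord k is [L k, L k + k + 2], where the
    heights L 0, L 1, ... weakly decrease by steps of at most 1. Reading the
    heights in the integers instead of modulo n turns the flips into the moves
    that change a single height by 1. The flip graph around the star, whose
    heights are all 0, is therefore the graph of such lattice paths modulo
    translation by multiples of n.

    The vertices of the polygon are accordingly indexed by all integers, and two
    segments are compared in a common window of n consecutive integers
    (diag_eq, external_diag, crossing_diag). Every lattice path yields an
    element of CTFT (colored_CTFT), raising a height is a flip (flip_raise), and
    conversely any element of CTFT that agrees with a lattice path on all
    labels but one comes from a lattice path that differs by at most 1 there
    (recolor_path). Walks in the flip graph that start at the star thus lift to
    walks of lattice paths (walk_lift).

    The reversed star has heights n - 2 - k, up to translation by q n, and the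
    sum of the distances |n - 2 - k + q n| is at least n (n - 3) / 2, with
    equality for q = 0 and q = -1 only. A geodesic thus changes every height
    monotonically; those for which q = 0 start by raising the height 0, that is,
    by flipping [0,2], and those for which q = -1 start by lowering one. Hence
    the geodesics of the theorem are exactly the ways to grow the heights from
    0 to n - 2 - k one unit at a time through lattice paths (growth_geodesic,
    Dplus_growth).

    Such a growth is a standard tableau: the step that raises the height k from
    r - 1 to r is written in the cell of row r on the diagonal
    column - row = k. The two inequalities that define lattice paths become the
    increase along rows and down columns (growth_of_growth,
    tableau_of_standard), and the chord flipped at that step,
    [r - 1, r - 1 + k + 2], is [row - 1, column + 1]. *)

(** * Segments of the polygon with integer endpoints *)

Section Polygon.

Variables (n : nat) (hn : 4 < n).
Local Open Scope ring_scope.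

Lemma vertex_subproof (z : int) : (`|(z %% n%:Z)%Z| < n)%N.
Proof. lia. Qed.

Definition zvertex (z : int) : 'I_n := Ordinal (vertex_subproof z).

Definition zdiag (a b : int) : {set 'I_n} := [set zvertex a; zvertex b].

Lemma vertex_small z : 0 <= z < n%:Z -> (zvertex z : nat)%:Z = z.
Proof. by move=> zn /=; rewrite modz_small; lia. Qed.

Lemma vertex_shift z q : zvertex (z + q * n%:Z) = zvertex z.
Proof. by apply: val_inj => /=; rewrite addrC modzMDl. Qed.

Lemma vertexDn z : zvertex (z + n%:Z) = zvertex z.
Proof. by rewrite -[in LHS](mul1r n%:Z) vertex_shift. Qed.

Lemma vertexBn z : zvertex (z - n%:Z) = zvertex z.
Proof. by rewrite -mulN1r vertex_shift. Qed.

Lemma vertex_nat (x : 'I_n) : zvertex (x : nat)%:Z = x.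
Proof. by apply: val_inj => /=; have := ltn_ord x => ?; rewrite modz_small; lia. Qed.

Lemma int_window (b z : int) : exists q, b <= z + q * n%:Z < b + n%:Z.
Proof.
exists (- ((z - b) %/ n%:Z)%Z).
have := divz_eq (z - b) n%:Z; have := modz_ge0 (z - b) (d := n%:Z).
have := ltz_pmod (z - b) (d := n%:Z); lia.
Qed.

Lemma vertex_onto b (x : 'I_n) : exists2 z, b <= z < b + n%:Z & x = zvertex z.
Proof.
have [q hq] := int_window b (x : nat)%:Z.
by exists ((x : nat)%:Z + q * n%:Z); rewrite ?vertex_shift ?vertex_nat.
Qed.

Lemma vertex_eq z w : `|z - w| < n%:Z -> (zvertex z == zvertex w) = (z == w).
Proof.
move=> zw; apply/eqP/eqP => [|-> //] /(congr1 val) /= e.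
have [q hq] : exists q, z - w = q * n%:Z.
  exists ((z %/ n%:Z)%Z - (w %/ n%:Z)%Z).
  have := divz_eq z n%:Z; have := divz_eq w n%:Z.
  have := modz_ge0 z (d := n%:Z); have := modz_ge0 w (d := n%:Z); lia.
have [q0|q0] : q = 0 \/ q <> 0 by lia.
  by rewrite q0 in hq; lia.
nia.
Qed.

Lemma diagC a b : zdiag a b = zdiag b a.
Proof. exact: setUC. Qed.

Lemma diag_shift a b q : zdiag (a + q * n%:Z) (b + q * n%:Z) = zdiag a b.
Proof. by rewrite /zdiag !vertex_shift. Qed.

Lemma set2_eq (T : finType) (a b c d : T) :
  ([set a; b] == [set c; d]) = (a == c) && (b == d) || (a == d) && (b == c).
Proof.
apply/eqP/idP => [e|/orP[]/andP[/eqP-> /eqP->] //]; last exact: setUC.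
have : a \in [set c; d] by rewrite -e !inE eqxx.
have : b \in [set c; d] by rewrite -e !inE eqxx orbT.
have : c \in [set a; b] by rewrite e !inE eqxx.
have : d \in [set a; b] by rewrite e !inE eqxx orbT.
rewrite !inE ![_ == a]eq_sym ![_ == b]eq_sym.
by case: (a == c); case: (a == d); case: (b == c); case: (b == d).
Qed.

(** On a window of n consecutive integers the vertex map is a bijection, so
    segments with increasing endpoints can be compared through them. *)
Lemma diag_eq w a b c d : w <= a < b -> b < w + n%:Z -> w <= c < d -> d < w + n%:Z ->
  (zdiag a b == zdiag c d) = (a == c) && (b == d).
Proof. move=> ha hb hc hd; rewrite set2_eq !vertex_eq; lia. Qed.

Lemma diag_card a b : `|a - b| < n%:Z -> a != b -> #|zdiag a b| = 2%N.
Proof. by move=> hab ne; rewrite cards2 vertex_eq // ne. Qed.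

Lemma diag_onto w (e : {set 'I_n}) : #|e| = 2%N ->
  exists a b, [/\ w <= a < b, b < w + n%:Z & e = zdiag a b].
Proof.
move=> /eqP/cards2P[x [y [xy ->]]].
have [a ha ax] := vertex_onto w x; have [b hb bx] := vertex_onto w y.
rewrite {}ax {}bx vertex_eq in xy *; last lia.
have [ab|ab] : a < b \/ b < a by lia.
  by exists a, b; split; rewrite //; lia.
by exists b, a; split; rewrite ?[zdiag b a]diagC //; lia.
Qed.

Lemma vertex_ordS z : ordS (zvertex z) = zvertex (z + 1).
Proof.
have zq : z = (zvertex z : nat)%:Z + (z %/ n%:Z)%Z * n%:Z.
  by have /= := divz_eq z n%:Z; have := modz_ge0 z (d := n%:Z); lia.
rewrite [in RHS]zq addrAC vertex_shift; apply: val_inj.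
by rewrite [RHS]/= -PoszD addn1 modz_nat.
Qed.

Lemma vertex_ord_pred z : ord_pred (zvertex z) = zvertex (z - 1).
Proof. by rewrite -[z in LHS](subrK 1) -vertex_ordS ordSK. Qed.

Lemma external_diag w a b : w <= a < b -> b < w + n%:Z ->
  (zdiag a b \in external n) = (b == a + 1) || (b == a + n%:Z - 1).
Proof.
move=> ha hb; apply/imsetP/idP => [[x _]|/orP[]/eqP->].
- have [z hz ->] := vertex_onto w x; rewrite vertex_ordS => /eqP.
  have [hz'|hz'] : z + 1 < w + n%:Z \/ z = w + n%:Z - 1 by lia.
    by rewrite -[_ == _]/(zdiag a b == zdiag z (z + 1)) (@diag_eq w); lia.
  have -> : zvertex (z + 1) = zvertex w by rewrite hz' subrK vertexDn.
  by rewrite setUC -[_ == _]/(zdiag a b == zdiag w z) (@diag_eq w); lia.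
- by exists (zvertex a); rewrite ?vertex_ordS.
- exists (zvertex (a - 1)); rewrite // vertex_ordS subrK diagC addrAC /zdiag.
  by rewrite vertexDn.
Qed.

Lemma internal_diag w a b : w <= a < b -> b < w + n%:Z ->
  (zdiag a b \in internal n) = (a + 1 < b) && (b < a + n%:Z - 1).
Proof.
by move=> ha hb; rewrite inE diag_card ?(external_diag ha hb) //=; lia.
Qed.

Lemma crossingC (e f : {set 'I_n}) : crossing e f = crossing f e.
Proof.
by do 4![apply: eq_existsb => ?]; rewrite orbC.
Qed.

Lemma crossing_ord (a b c d : 'I_n) : (a < b < c)%N -> (c < d)%N ->
  crossing [set a; c] [set b; d].
Proof.
move=> /andP[ab bc] cd; apply/existsP; exists a; apply/existsP; exists b.
apply/existsP; exists c; apply/existsP; exists d.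
by rewrite ab bc cd !eqxx.
Qed.

Lemma crossing_diags a b c d : a < b < c -> c < d < a + n%:Z ->
  crossing (zdiag a c) (zdiag b d).
Proof.
move=> hb hc; have [q hq] := int_window 0 a.
rewrite -(diag_shift a c q) -(diag_shift b d q).
have {}hb : a + q * n%:Z < b + q * n%:Z < c + q * n%:Z by rewrite !ltrD2r.
have {}hc : c + q * n%:Z < d + q * n%:Z < a + q * n%:Z + n%:Z.
  by rewrite addrAC !ltrD2r.
move: (a + _) (b + _) (c + _) (d + _) hq hb hc => {b c d}{}a b c d ha hb hc.
have cr u v x y : 0 <= u -> u < v -> v < x -> x < y -> y < n%:Z ->
    crossing (zdiag u x) (zdiag v y).
  by move=> *; apply: crossing_ord; rewrite -?ltz_nat !vertex_small; lia.
(* 0 <= a < n, so each of b, c, d either lies below n or wraps around once *)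
have [hdn|hdn] := ltrP d n%:Z; first by apply: cr; lia.
rewrite [zdiag b d]diagC /zdiag -(vertexBn d).
have [hcn|hcn] := ltrP c n%:Z; first by rewrite crossingC; apply: cr; lia.
rewrite [X in crossing X]setUC -(vertexBn c).
have [hbn|hbn] := ltrP b n%:Z; first by apply: cr; lia.
by rewrite crossingC [X in crossing X]setUC -(vertexBn b); apply: cr; lia.
Qed.

(** Crossing is defined by the linear order of the labels 0, ..., n - 1, but it
    is invariant under rotation: the four endpoints may be cut open at any
    vertex, at the price of exchanging the two segments. *)
Lemma crossing_window w (e f : {set 'I_n}) : crossing e f ->
  exists a b c d, [/\ w <= a < b, b < c < d, d < w + n%:Z &
    (e = zdiag a c /\ f = zdiag b d) \/ (f = zdiag a c /\ e = zdiag b d)].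
Proof.
move=> /existsP[a /existsP[b /existsP[c /existsP[d /and4P[ab bc cd ef]]]]].
have {}ef : (e = [set a; c] /\ f = [set b; d]) \/
            (f = [set a; c] /\ e = [set b; d]).
  by case/orP: ef => /andP[/eqP-> /eqP->]; [left|right].
have [q hq] := int_window 0 w.
suff: exists x y z t, [/\ w + q * n%:Z <= x < y, y < z < t,
    t < w + q * n%:Z + n%:Z & ([set a; c] = zdiag x z /\ [set b; d] = zdiag y t) \/
    ([set a; c] = zdiag y t /\ [set b; d] = zdiag x z)].
  move=> [x [y [z [t [hx hz ht acbd]]]]].
  exists (x - q * n%:Z), (y - q * n%:Z), (z - q * n%:Z), (t - q * n%:Z).
  split; [lia..|]; rewrite -mulNr !diag_shift.
  by case: ef => -[-> ->]; case: acbd => -[-> ->]; [left|right|right|left].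
move: (w + _) hq => {ef e f}{}w hw.
have lift (x : 'I_n) : exists2 z, w <= z < w + n%:Z /\
    ((x : nat)%:Z = z /\ z < n%:Z \/ (x : nat)%:Z = z - n%:Z /\ n%:Z <= z)
    & x = zvertex z.
  have [z hz ->] := vertex_onto w x; exists z => //; split => //.
  have [zn|zn] := ltrP z n%:Z; first by left; rewrite vertex_small //; lia.
  by right; rewrite -vertexBn vertex_small //; lia.
have [za [ea ha] ->] := lift a; have [zb [eb hb] ->] := lift b.
have [zc [ec hc] ->] := lift c; have [zd [ed hd] ->] := lift d.
(* the window starts at w: sort according to which endpoints wrap around *)
have [wa|wa] := lerP w (a : nat)%:Z.
  by exists za, zb, zc, zd; split; try lia; left.
have [wb|wb] := lerP w (b : nat)%:Z.
  by exists zb, zc, zd, za; split; try lia; right; split; rewrite // setUC.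
have [wc|wc] := lerP w (c : nat)%:Z.
  by exists zc, zd, za, zb; split; try lia; left; split; rewrite // setUC.
have [wd|wd] := lerP w (d : nat)%:Z.
  by exists zd, za, zb, zc; split; try lia; right; split; rewrite // setUC.
by exists za, zb, zc, zd; split; try lia; left.
Qed.

Lemma crossing_diag w a b c d :
  w <= a < b -> b < w + n%:Z -> w <= c < d -> d < w + n%:Z ->
  crossing (zdiag a b) (zdiag c d) = (a < c < b) && (b < d) || (c < a < d) && (d < b).
Proof.
move=> ha hb hc hd; apply/idP/idP => [/(crossing_window w)|/orP[]/andP[h1 h2]].
- move=> [x [y [z [t [hx hy hz]]]]].
  by case=> -[/eqP + /eqP]; rewrite !(@diag_eq w); lia.
- by apply: crossing_diags; lia.
- by rewrite crossingC; apply: crossing_diags; lia.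
Qed.

End Polygon.

(** * Lattice paths and the colored triangulations they describe *)

Section LatticePaths.

Variable n : nat.
Local Open Scope ring_scope.

Definition lattice_path (L : nat -> int) :=
  forall k, (k.+1 < n - 3)%N -> L k.+1 <= L k <= L k.+1 + 1.

Definition top (L : nat -> int) k : int := L k + k%:Z + 2.

Lemma lattice_path_mono L j k : lattice_path L -> (j <= k < n - 3)%N ->
  L k <= L j <= L k + (k - j)%N%:Z.
Proof.
move=> hL /andP[/subnK <-]; elim: (k - j)%N => {k}[|d IH] hk.
  by rewrite add0n; lia.
have hk1 : (d + j < n - 3)%N by lia.
have hk2 : ((d + j).+1 < n - 3)%N by lia.
by move: (IH hk1) (hL _ hk2); rewrite addSn; lia.
Qed.

Lemma spans_nested L j k : lattice_path L -> (j <= k < n - 3)%N ->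
  L k <= L j /\ top L j <= top L k.
Proof. by move=> hL hj; have := lattice_path_mono hL hj; rewrite /top; lia. Qed.

Hypothesis hn : (4 < n)%N.
Local Notation vertex := (zvertex hn).
Local Notation diag := (zdiag hn).

Definition path_chord (L : nat -> int) k : {set 'I_n} := diag (L k) (top L k).

Definition path_coloring (L : nat -> int) : coloring n :=
  [ffun k : 'I_(n - 3) => path_chord L k].

Local Notation chord := path_chord.
Local Notation colored := path_coloring.

Lemma chords_colored L e :
  reflect (exists2 k, (k < n - 3)%N & e = chord L k) (e \in chords (colored L)).
Proof.
apply: (iffP imsetP) => [[k _ ->]|[k hk ->]]; first by exists k; rewrite ?ffunE.
by exists (Ordinal hk); rewrite ?ffunE.
Qed.

(** Turning around the polygon, the chord k also spans its other side. *)
Lemma chordC L k : chord L k = diag (top L k) (L k + n%:Z).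
Proof. by rewrite /chord diagC /zdiag vertexDn. Qed.

(** The chords of labels at most k triangulate the part of the polygon that the
    chord k cuts off on its own side, hence no other diagonal fits there. *)
Lemma diagonal_inside L k x y : lattice_path L -> (k < n - 3)%N ->
  L k <= x -> x + 1 < y -> y <= top L k ->
  (forall j, (j <= k)%N -> ~~ crossing (diag x y) (chord L j)) ->
  exists2 j, (j <= k)%N & diag x y = chord L j.
Proof.
move=> hL; elim: k => [|k IH] hk hx hxy hy hc.
  by exists 0%N => //; rewrite /top in hy *; rewrite /chord /top; congr diag; lia.
have hk' := hL k hk; have hck := hc k (leqnSn k).
case: (boolP ((L k <= x) && (y <= top L k))) => [/andP[hx1 hy1]|hxy1].
  have [j jk ->] := IH (ltnW hk) hx1 hxy hy1 (fun j hj => hc j (leqW hj)).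
  by exists j; rewrite // leqW.
exists k.+1 => //; rewrite /chord /top in hck hxy1 hy *.
by congr diag; move: hck; rewrite (@crossing_diag _ _ (L k.+1)); lia.
Qed.

(** The same on the other side of the chord k, by induction from the last label
    downwards. *)
Lemma diagonal_outside L k x y : lattice_path L -> (k < n - 3)%N ->
  top L k <= x -> x + 1 < y -> y <= L k + n%:Z ->
  (forall j, (k <= j < n - 3)%N -> ~~ crossing (diag x y) (chord L j)) ->
  exists2 j, (k <= j < n - 3)%N & diag x y = chord L j.
Proof.
move=> hL hk; have [d] := ubnPeq (n - 3 - k)%N.
elim: d k hk => [|d IH] k hk hd hx hxy hy hc; first by lia.
have [hk1|hk1] : (k = n - 4)%N \/ (k.+1 < n - 3)%N by lia.
  by exists k; [lia|rewrite /top in hx *; rewrite chordC /top; congr diag; lia].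
have hk' := hL k hk1; have := hc k.+1; rewrite leqnSn hk1 => /(_ isT) hck.
case: (boolP ((top L k.+1 <= x) && (y <= L k.+1 + n%:Z))) => [/andP[hx1 hy1]|hxy1].
  have [||j jk ->] := IH k.+1 hk1 _ hx1 hxy hy1; first by lia.
    by move=> j jk; apply: hc; lia.
  by exists j => //; lia.
exists k; first by lia.
rewrite (chordC L k.+1) in hck; rewrite (chordC L k) /top in hck hxy1 hx *.
by congr diag; move: hck; rewrite (@crossing_diag _ _ (L k + k%:Z + 2)); lia.
Qed.

Lemma chord_internal L k : (k < n - 3)%N -> chord L k \in internal n.
Proof. by move=> hk; rewrite /chord /top (@internal_diag _ _ (L k)); lia. Qed.

Lemma chord_noncrossing L j k : lattice_path L -> (j < n - 3)%N -> (k < n - 3)%N ->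
  ~~ crossing (chord L j) (chord L k).
Proof.
move=> hL; wlog jk : j k / (j <= k)%N => [hw hj hk|hj hk].
  by case/orP: (leq_total j k) => jk; [|rewrite crossingC]; apply: hw.
have [h1 h2] : L k <= L j /\ top L j <= top L k by apply: spans_nested => //; lia.
rewrite /chord /top in h2 *; rewrite (@crossing_diag _ _ (L k)); lia.
Qed.

Lemma chord_inj L j k : lattice_path L -> (j < n - 3)%N -> (k < n - 3)%N ->
  chord L j = chord L k -> j = k.
Proof.
move=> hL; wlog jk : j k / (j <= k)%N => [hw hj hk e|hj hk /eqP].
  by case/orP: (leq_total j k) => jk; [|symmetry]; apply: hw.
have [h1 h2] : L k <= L j /\ top L j <= top L k by apply: spans_nested => //; lia.
by rewrite /chord /top in h2 *; rewrite (@diag_eq _ _ (L k)); lia.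
Qed.

Lemma noncrossing_colored L : lattice_path L -> noncrossing (chords (colored L)).
Proof.
move=> hL; apply/andP; split.
  by apply/subsetP => e /chords_colored[k hk ->]; apply: chord_internal.
apply/forall_inP => e /chords_colored[k hk ->].
by apply/forall_inP => f /chords_colored[j hj ->]; apply: chord_noncrossing.
Qed.

Lemma internal_onto w (e : {set 'I_n}) : e \in internal n ->
  exists a b, [/\ w <= a, a + 1 < b, b < w + n%:Z, b < a + n%:Z - 1 & e = diag a b].
Proof.
move=> he; have /andP[/eqP he2 _] : (#|e| == 2%N) && (e \notin external n).
  by move: he; rewrite inE.
have [a [b [ha hb eab]]] := diag_onto hn w he2; exists a, b.
by move: he; rewrite eab (@internal_diag _ _ w) //; split; rewrite //; lia.
Qed.

Lemma triangulation_colored L : lattice_path L -> triangulation (chords (colored L)).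
Proof.
move=> hL; apply/maxsetP; split; first exact: noncrossing_colored.
move=> B /andP[/subsetP Bint /forall_inP Bnc] sub.
apply/eqP; rewrite eqEsubset sub andbT; apply/subsetP => e eB.
have [a [b [ha hab hb hb' ee]]] := internal_onto (L 0%N) (Bint _ eB).
have hc j : (j < n - 3)%N -> ~~ crossing (diag a b) (chord L j).
  move=> hj; rewrite -ee; have /forall_inP := Bnc _ eB; apply.
  by apply: (subsetP sub); apply/chords_colored; exists j.
have n3 : (0 < n - 3)%N by lia.
have hc0 := hc _ n3; rewrite /chord /top (@crossing_diag _ _ (L 0%N)) in hc0; try lia.
apply/chords_colored; rewrite ee.
have [hbt|hbt] := lerP b (top L 0).
  have hc' j : (j <= 0)%N -> ~~ crossing (diag a b) (chord L j).
    by move=> j0; apply: hc; lia.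
  have [j j0 ->] := diagonal_inside hL n3 ha hab hbt hc'.
  by exists j => //; lia.
have [hta|hta] := lerP (top L 0) a.
  have [|j jn ->] := diagonal_outside hL n3 hta hab (ltW hb).
    by move=> j /andP[_]; apply: hc.
  by exists j.
have ab : diag a b = diag b (a + n%:Z) by rewrite diagC /zdiag vertexDn.
(* here a = L 0 and b lies beyond the chord 0: read the segment from b *)
rewrite ab in hc *; rewrite /top in hbt hta.
have [| | | |j jn ->] := @diagonal_outside L 0 b (a + n%:Z) hL n3.
- by rewrite /top; lia.
- by lia.
- by lia.
- by move=> j /andP[_]; apply: hc.
by exists j.
Qed.

(** The segment lies within the span of the chord k and meets that of the chord j
    in one endpoint only, whereas the spans of any two chords are nested. *)
Lemma diag_not_chord L j k a b : lattice_path L -> (j < k < n - 3)%N ->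
  L k <= a < b -> b <= top L k ->
  a = top L j \/ b = L j -> diag a b \notin chords (colored L).
Proof.
move=> hL jk ha hb hab; apply/chords_colored => -[i hi /eqP].
have nest u v : (u <= v < n - 3)%N -> L v <= L u /\ top L u <= top L v.
  exact: spans_nested.
have [ik|ki] := leqP i k.
  have ik3 : (i <= k < n - 3)%N by lia.
  have [h1 h2] := nest i k ik3; have [jk3 ji] : (j <= k < n - 3)%N /\
     ((i <= j < n - 3) \/ (j <= i < n - 3))%N by lia.
  have [h3 h4] := nest j k jk3.
  rewrite /chord (@diag_eq _ _ (L k)); try by rewrite /top in h2 h4 hb hab *; lia.
  case: ji => /nest[h5 h6]; rewrite /top in h2 h4 h5 h6 hb hab *; lia.
have [h1 h2] : L i <= L k /\ top L k <= top L i by apply: nest; lia.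
have [h3 h4] : L k <= L j /\ top L j <= top L k by apply: nest; lia.
rewrite /top in h2 h4 hb hab *.
by rewrite /chord /top (@diag_eq _ _ (L i)); lia.
Qed.

(** Two nested chords on a common triangle share an endpoint, so the third side
    joins their other endpoints. It lies between two nested chords, hence is no
    chord itself; being an edge of the polygon, it forces consecutive widths. *)
Lemma two_chords_triangle L t j k : lattice_path L ->
  t \in triangles (chords (colored L)) -> (j < k < n - 3)%N ->
  chord L j \subset t -> chord L k \subset t ->
  k = j.+1 /\ exists2 e, e \in sides t & e \notin chords (colored L).
Proof.
move=> hL; rewrite inE => /andP[/eqP t3 /subsetP tsides] jk.
rewrite !subUset !sub1set => /andP[tlj ttj] /andP[tlk ttk].
have [h1 h2] : L k <= L j /\ top L j <= top L k by apply: spans_nested => //; lia.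
have side a b : vertex a \in t -> vertex b \in t -> L k <= a < b -> b <= top L k ->
    a = top L j \/ b = L j ->
    (b = a + 1) /\ exists2 e, e \in sides t & e \notin chords (colored L).
  move=> ta tb ha hb hab; have sab : diag a b \in sides t.
    rewrite inE subUset !sub1set ta tb diag_card //; rewrite /top in hb; lia.
  have nch := diag_not_chord hL jk ha hb hab.
  split; last by exists (diag a b).
  have := tsides _ sab; rewrite inE (negPf nch) orbF.
  by rewrite /top in hb; rewrite (@external_diag _ _ (L k)); lia.
have [e|ne] := eqVneq (L j) (L k).
  have [|||t1 t2] := side (top L j) (top L k) ttj ttk; rewrite /top in h2 *; try lia.
  by split=> //; rewrite /top in t1; lia.
have [e|ne'] := eqVneq (top L j) (top L k).
  have [|||t1 t2] := side (L k) (L j) tlk tlj; rewrite /top in h2 e *; try lia.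
  by split=> //; lia.
(* otherwise the two chords have four distinct endpoints in t *)
have us : uniq [:: vertex (L k); vertex (L j); vertex (top L j); vertex (top L k)].
  rewrite /= !inE !vertex_eq; rewrite /top in h2 ne' *; lia.
suff /(uniq_leq_size us) : {subset [:: vertex (L k); vertex (L j); vertex (top L j);
    vertex (top L k)] <= enum t} by rewrite -cardE t3.
by move=> x; rewrite mem_enum !inE => /or4P[]/eqP->.
Qed.

Lemma triangle_free_colored L : lattice_path L -> triangle_free (chords (colored L)).
Proof.
move=> hL; apply/forall_inP => t tT; apply/eqP => s3.
have t3 : #|sides t| = 3%N by move: tT; rewrite inE cards_draws => /andP[/eqP->].
have sub : sides t \subset chords (colored L).
  by apply/setIidPl/eqP; rewrite eqEcard subsetIl s3 t3.
have /card_gt1P[e [f [es fs ef]]] : (1 < #|sides t|)%N by rewrite t3.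
have /chords_colored[j hj ej] := subsetP sub e es.
have /chords_colored[k hk fk] := subsetP sub f fs.
have {}ef : j != k by apply: contra_neq ef => jk; rewrite ej fk jk.
move: es fs; rewrite ej fk !inE => /andP[es _] /andP[fs _].
have noside u v : (u < v < n - 3)%N -> chord L u \subset t -> ~ chord L v \subset t.
  move=> uv su sv; have [_ [g gs]] := two_chords_triangle hL tT uv su sv.
  by rewrite (subsetP sub).
have [jk|kj] : (j < k \/ k < j)%N by lia.
  by apply: (noside j k); rewrite ?jk.
by apply: (noside k j); rewrite ?kj.
Qed.

Lemma chord0_short L : short_chord (chord L 0).
Proof.
apply/existsP; exists (vertex (L 0%N + 1)); apply/eqP.
by rewrite vertex_ord_pred vertex_ordS addrK -addrA /chord /top addr0.
Qed.

Lemma colored_CTFT L : lattice_path L -> colored L \in CTFT n.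
Proof.
move=> hL; rewrite inE triangulation_colored // triangle_free_colored //=.
have n3 : (0 < n - 3)%N by lia.
apply/and3P; split.
- apply/injectiveP => j k; rewrite !ffunE => /(chord_inj hL (ltn_ord j) (ltn_ord k)).
  exact: val_inj.
- by apply/existsP; exists (Ordinal n3); rewrite ffunE chord0_short.
apply/forall_inP => t tT; apply/implyP => _; apply/forallP => k; apply/forallP => l.
apply/implyP => /and3P[]; rewrite !ffunE !inE => /andP[sk _] /andP[sl _] kl.
by apply/eqP; case: (@two_chords_triangle L t k l) => //; rewrite kl /=.
Qed.

End LatticePaths.

(** * Flips are unit moves of lattice paths *)

Section Flips.

Variable n : nat.

Lemma flip_off (C C' : coloring n) e : flip C e C' -> exists k : 'I_(n - 3),
  [/\ C k = e, forall j, j != k -> C' j = C j & e != set0 -> C' k != e].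
Proof.
move=> /existsP[k /exists_inP[t1 _ /exists_inP[t2 _ /and5P[/eqP ck _ _ _ /eqP->]]]].
exists k; split=> // [j jk|]; first by rewrite ffunE (negPf jk).
move=> /set0Pn[x xe]; rewrite ffunE eqxx; apply/eqP => h.
by move: (xe); rewrite -{1}h in_setD xe.
Qed.

Hypothesis hn : (4 < n)%N.
Local Open Scope ring_scope.
Local Notation vertex := (zvertex hn).
Local Notation diag := (zdiag hn).
Local Notation chord := (path_chord hn).
Local Notation colored := (path_coloring hn).
Local Notation lattice_path := (lattice_path n).

Lemma sides_triangle a b c e : e \in sides [set vertex a; vertex b; vertex c] ->
  [\/ e = diag a b, e = diag b c | e = diag a c].
Proof.
rewrite inE => /andP[es /cards2P[x [y [xy exy]]]].
move: es; rewrite exy subUset !sub1set !inE => /andP[ex ey].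
move: ex ey xy => /orP[/orP[]|]/eqP-> /orP[/orP[]|]/eqP->; rewrite ?eqxx // => _.
all: rewrite /zdiag.
- by constructor 1.
- by constructor 3.
- by constructor 1; rewrite setUC.
- by constructor 2.
- by constructor 3; rewrite setUC.
- by constructor 2; rewrite setUC.
Qed.

Lemma triangle_card a b c : a < b < c -> c < a + n%:Z ->
  #|[set vertex a; vertex b; vertex c]| = 3%N.
Proof.
move=> ab bc; rewrite setUC cardsU1 cards2 !inE !vertex_eq; lia.
Qed.

Lemma mem_triangles T a b c : a < b < c -> c < a + n%:Z ->
  diag a b \in external n :|: T -> diag b c \in external n :|: T ->
  diag a c \in external n :|: T -> [set vertex a; vertex b; vertex c] \in triangles T.
Proof.
move=> ab bc h1 h2 h3; rewrite inE triangle_card //=.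
by apply/subsetP => e /sides_triangle[]->.
Qed.

Lemma no_inner_triangle T a b c : triangle_free T -> a < b < c -> c < a + n%:Z ->
  diag a b \in T -> diag b c \in T -> diag a c \in T -> False.
Proof.
move=> Tfree ab bc h1 h2 h3.
have : [set vertex a; vertex b; vertex c] \in triangles T.
  by apply: mem_triangles; rewrite // inE ?h1 ?h2 ?h3 orbT.
move=> /(forall_inP Tfree) /eqP; apply.
rewrite (setIidPl _) ?cards_draws ?triangle_card //.
by apply/subsetP => e /sides_triangle[]->.
Qed.

(** The quadrangle has vertices L k, L k + 1, top L k and top L k + 1. Two of its
    sides are polygon edges. That both L and L' are lattice paths makes the
    other two the chords k - 1 and k + 1, or polygon edges at the ends of the
    range of labels. *)
Lemma flip_raise L L' (k : nat) : lattice_path L -> lattice_path L' -> (k < n - 3)%N ->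
  L' k = L k + 1 -> (forall j, (j < n - 3)%N -> j <> k -> L' j = L j) ->
  flip (colored L) (chord L k) (colored L').
Proof.
move=> hL hL' hk L'k L'j.
have low : diag (L k + 1) (top L k) \in external n :|: chords (colored L).
  rewrite in_setU; apply/orP; have [k0|k0] := posnP k.
    by left; rewrite k0 /top (@external_diag _ _ (L 0%N + 1)); lia.
  right; apply/chords_colored; exists k.-1; first by lia.
  have e : k = k.-1.+1 by lia.
  have := hL k.-1; have := hL' k.-1; rewrite -e => /(_ hk) h1 /(_ hk) h2.
  have := L'j k.-1; rewrite /chord /top => h3; congr diag; lia.
have high : diag (L k) (top L k + 1) \in external n :|: chords (colored L).
  rewrite in_setU; apply/orP; have [k1|k1] := ltnP k.+1 (n - 3)%N; last first.
    by left; rewrite /top (@external_diag _ _ (L k)); lia.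
  right; apply/chords_colored; exists k.+1; first by lia.
  have := hL k k1; have := hL' k k1; have := L'j k.+1 k1.
  by rewrite /chord /top => *; congr diag; lia.
have mid : diag (L k) (top L k) \in external n :|: chords (colored L).
  by rewrite in_setU orbC; apply/orP; left; apply/chords_colored; exists k.
have ext a : diag a (a + 1) \in external n :|: chords (colored L).
  by rewrite in_setU (@external_diag _ _ a) ?eqxx //; lia.
apply/existsP; exists (Ordinal hk).
apply/exists_inP; exists [set vertex (L k); vertex (L k + 1); vertex (top L k)].
  by apply: mem_triangles => //; rewrite /top; lia.
apply/exists_inP; exists [set vertex (L k); vertex (top L k); vertex (top L k + 1)].
  by apply: mem_triangles => //; rewrite /top; lia.
have e2 : #|chord L k| == 2%N by rewrite diag_card // /top; lia.
apply/and5P; split.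
- by rewrite ffunE.
- apply/eqP => /setP/(_ (vertex (L k + 1))).
  by rewrite !inE !vertex_eq /top; lia.
- rewrite inE e2 andbT; apply/subsetP => x; rewrite !inE => /orP[]->; by rewrite ?orbT.
- rewrite inE e2 andbT; apply/subsetP => x; rewrite !inE => /orP[]->; by rewrite ?orbT.
apply/eqP/ffunP => l; rewrite !ffunE; case: eqP => [->|lk].
  apply/setP => x; have [z hz ->] := vertex_onto hn (L k) x.
  by rewrite /path_chord /top /= L'k !inE !vertex_eq; lia.
have lk' : (l : nat) <> k by move=> e; apply: lk; apply: val_inj.
by rewrite /path_chord /top !L'j.
Qed.

(** A diagonal that does not cross the chord k lies on one of its sides; its
    endpoints may have to be exchanged to read it there. *)
Lemma diagonal_side L k f : (k < n - 3)%N -> f \in internal n ->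
  ~~ crossing f (chord L k) ->
  exists a b, [/\ f = diag a b, a + 1 < b &
    L k <= a /\ b <= top L k \/ top L k <= a /\ b <= L k + n%:Z].
Proof.
move=> hk fi; have [a [b [ha hab hb hb' ->]]] := internal_onto hn (L k) fi.
rewrite /path_chord /top (@crossing_diag _ _ (L k)); try lia; move=> nc.
have [bt|bt] := lerP b (L k + k%:Z + 2); first by exists a, b; split; rewrite //; left.
have [ta|ta] := lerP (L k + k%:Z + 2) a.
  by exists a, b; split; rewrite //; right; lia.
by exists b, (a + n%:Z); rewrite diagC /zdiag vertexDn; split; rewrite //; lia.
Qed.

(** The local structure of the flip graph: when the chords other than the one
    of label k stay put, the missing chord is a diagonal of the quadrangle that
    they leave open, and the one that would create an inner triangle is
    excluded. *)
Lemma recolor_path L C k : lattice_path L -> (k < n - 3)%N -> C \in CTFT n ->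
  (forall j : 'I_(n - 3), (j : nat) <> k -> C j = chord L j) ->
  exists L', [/\ lattice_path L', C = colored L', `|L' k - L k| <= 1 &
    forall j, j <> k -> L' j = L j].
Proof.
move=> hL hk; rewrite inE => /and3P[Ctri Cfree Cprop] Cj.
have [/andP[/subsetP Cint /forall_inP Cnc] _] := maxsetP Ctri.
have /and3P[/injectiveP Cinj _ _] := Cprop.
pose f := C (Ordinal hk); pose T := chords C.
have memC (j : 'I_(n - 3)) : C j \in T by apply: imset_f.
have memL j : (j < n - 3)%N -> j <> k -> chord L j \in T.
  by move=> hj jk; rewrite -(Cj (Ordinal hj) jk) memC.
have fT : f \in T := memC _.
have fi : f \in internal n by apply: Cint.
have fL j : (j < n - 3)%N -> j <> k -> f <> chord L j.
  move=> hj jk; rewrite -(Cj (Ordinal hj) jk) => /Cinj [e].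
  by apply: jk.
have fnc j : (j < n - 3)%N -> j <> k -> ~~ crossing f (chord L j).
  by move=> hj jk; have /forall_inP := Cnc _ fT; apply; apply: memL.
(* z is the new height at k; the bounds are those that a lattice path asks of
   its neighbours *)
suff [z [fz z1 zlow zhigh]] : exists z, [/\ f = diag z (z + k%:Z + 2), `|z - L k| <= 1,
    (0 < k)%N -> z <= L k.-1 <= z + 1 & (k.+1 < n - 3)%N -> L k.+1 <= z <= L k.+1 + 1].
  exists (fun j => if j == k then z else L j); split.
  - move=> j hj; have [jk|jk] := eqVneq j k.
      by rewrite jk eqn_leq ltnn /= in hj *; apply: zhigh.
    by have [jk'|_] := eqVneq j.+1 k; [move: zlow; rewrite -jk'; apply|apply: hL].
  - apply/ffunP => j; rewrite ffunE /path_chord /top.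
    have [jk|/eqP jk] := eqVneq (j : nat) k; last exact: Cj.
    by rewrite jk -fz; congr (C _); apply: val_inj.
  - by rewrite eqxx.
  - by move=> j /eqP/negPf->.
have noin j x y : (j < k)%N -> L j <= x -> x + 1 < y -> y <= top L j -> f <> diag x y.
  move=> jk hx hxy hy fxy; have j3 : (j < n - 3)%N by lia.
  have [|i ij e] := @diagonal_inside n hn _ _ _ _ hL j3 hx hxy hy.
    by move=> i ij; rewrite -fxy; apply: fnc; lia.
  by case: (fL i); rewrite ?fxy //; lia.
have noout j x y : (k < j < n - 3)%N -> top L j <= x -> x + 1 < y -> y <= L j + n%:Z ->
    f <> diag x y.
  move=> /andP[jk j3] hx hxy hy fxy.
  have [|i ij e] := @diagonal_outside n hn _ _ _ _ hL j3 hx hxy hy.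
    by move=> i ij; rewrite -fxy; apply: fnc; lia.
  by case: (fL i); rewrite ?fxy //; lia.
have [k0|k0] := posnP k.
  (* the open quadrangle is bounded by the chord 1 and three edges *)
  have h1 : (1 < n - 3)%N by lia.
  have n1 : 1%N <> k by rewrite k0.
  have [x [y [fxy xy]]] := diagonal_side h1 fi (fnc 1%N h1 n1).
  case=> -[hx hy]; last by case: (noout 1%N x y) => //; rewrite k0.
  have nf1 : ~ (x = L 1%N /\ y = top L 1).
    by move=> [ex ey]; apply: (fL 1%N) => //; rewrite fxy ex ey.
  have hL1 := hL 0%N h1; rewrite /top in hy nf1; exists x; rewrite k0; split.
  - by rewrite fxy; congr diag; lia.
  - by lia.
  - by [].
  - by lia.
have k1n : (k.-1 < n - 3)%N by lia.
have k1k : k.-1 <> k by lia.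
have kE : k = k.-1.+1 by lia.
have hLk := hL k.-1; rewrite -kE in hLk; have {}hLk := hLk hk.
have fnc1 := fnc _ k1n k1k; have fL1 := fL _ k1n k1k.
have [k2|k2] := leqP (n - 3)%N k.+1.
  (* symmetrically, bounded by the chord k.-1 and three edges *)
  have [x [y [fxy xy]]] := diagonal_side k1n fi fnc1.
  case=> -[hx hy]; first by case: (noin k.-1 x y) => //; lia.
  have nf1 : ~ (x = top L k.-1 /\ y = L k.-1 + n%:Z).
    by move=> [ex ey]; apply: fL1; rewrite fxy ex ey chordC.
  rewrite /top in hx nf1; exists (y - n%:Z); split; [|lia..].
  by rewrite fxy diagC /zdiag vertexBn; congr [set _; vertex _]; lia.
have hLk2 := hL k k2.
have kk2 : k.+1 <> k by lia.
have fnc2 := fnc _ k2 kk2; have fL2 := fL _ k2 kk2.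
have [x [y [fxy xy]]] := diagonal_side k2 fi fnc2.
case=> -[hx hy]; last by case: (noout k.+1 x y) => //; rewrite leqnn.
move: fnc1; rewrite fxy /path_chord (@crossing_diag _ _ (L k.+1));
  try by rewrite /top in hy *; lia.
move=> fnc1.
have nf1 : ~ (L k.-1 <= x /\ y <= top L k.-1).
  by move=> [ex ey]; apply: (noin k.-1 x y) => //; lia.
have nf2 : ~ (x = L k.+1 /\ y = top L k.+1).
  by move=> [ex ey]; apply: fL2; rewrite fxy ex ey.
have m1 := memL _ k1n k1k; have m2 := memL _ k2 kk2.
(* the two diagonals that close an inner triangle with the chords k.-1, k.+1 *)
have nf3 : ~ (x = L k.+1 /\ y = L k.-1).
  move=> [ex ey]; rewrite /top in hy nf1; rewrite /path_chord /top in m1 m2.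
  have ey' : L k.-1 + k.-1%:Z + 2 = L k.+1 + k.+1%:Z + 2 by lia.
  rewrite ey' -ey in m1.
  by apply: (no_inner_triangle Cfree _ _ _ m1 m2); rewrite -?ex -?fxy //; lia.
have nf4 : ~ (x = top L k.-1 /\ y = top L k.+1).
  move=> [ex ey]; rewrite /top in ex ey hy nf1; rewrite /path_chord /top in m1 m2.
  have ey' : L k.-1 = L k.+1 by lia.
  rewrite -ex ey' in m1; rewrite -ey in m2.
  by apply: (no_inner_triangle Cfree _ _ m1 _ m2); rewrite -?fxy //; lia.
rewrite /top in hy nf1 nf2 nf3 nf4 fnc1.
exists x; split; [|lia..].
by congr diag; lia.
Qed.

End Flips.

(** * Lifting walks, and the distance from the star to its reversal *)

Section Walks.

Variable n : nat.
Local Open Scope ring_scope.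
Local Notation lattice_path := (lattice_path n).

Definition origin : nat -> int := fun=> 0.
Definition target : nat -> int := fun k => n%:Z - 2 - k%:Z.

Lemma origin_path : lattice_path origin.
Proof. by []. Qed.

Lemma target_path : lattice_path target.
Proof. by move=> k hk; rewrite /target; lia. Qed.

Definition dist (L L' : nat -> int) : int := \sum_(k < n - 3) `|L' k - L k|.

Lemma eq_dist L1 L2 L1' L2' : (forall k, (k < n - 3)%N -> L1 k = L1' k) ->
  (forall k, (k < n - 3)%N -> L2 k = L2' k) -> dist L1 L2 = dist L1' L2'.
Proof. by move=> e1 e2; apply: eq_bigr => k _; rewrite e1 ?e2. Qed.

Lemma dist_triangle L1 L2 L3 : dist L1 L3 <= dist L1 L2 + dist L2 L3.
Proof. by rewrite -big_split /=; apply: ler_sum => k _; lia. Qed.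

(** The moves of lattice paths are allowed to stay put: the upper bound on
    distances is all that the lift of a walk has to provide. *)
Definition step (L L' : nat -> int) := exists k, [/\ (k < n - 3)%N,
  `|L' k - L k| <= 1 & forall j, j <> k -> L' j = L j].

Lemma dist_step L L' : step L L' -> dist L L' <= 1.
Proof.
move=> [k [hk hk1 hj]]; rewrite /dist (bigD1 (Ordinal hk)) //= big1 ?addr0 // => j jk.
rewrite hj ?subrr ?normr0 // => ejk; case/eqP: jk; exact: val_inj.
Qed.

Lemma dist_walk (M : nat -> nat -> int) N i j : (i <= j <= N)%N ->
  (forall i, (i < N)%N -> step (M i) (M i.+1)) -> dist (M i) (M j) <= (j - i)%N%:Z.
Proof.
move=> + st; elim: j => [|j IH] hij.
  have -> : i = 0%N by lia.
  by rewrite /dist big1 // => k _; rewrite subrr normr0.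
have [e|ij] : i = j.+1 \/ (i <= j <= N)%N by lia.
  by rewrite e subnn /dist big1 // => k _; rewrite subrr normr0.
apply: le_trans (dist_triangle _ (M j) _) _.
have jN : (j < N)%N by lia.
have := dist_step (st j jN); have := IH ij; lia.
Qed.

(** Equality in the triangle inequality for dist holds coordinatewise. *)
Lemma dist_between L1 L2 L3 k : dist L1 L2 + dist L2 L3 <= dist L1 L3 ->
  (k < n - 3)%N -> `|L2 k - L1 k| + `|L3 k - L2 k| = `|L3 k - L1 k|.
Proof.
rewrite /dist -big_split /= -subr_le0 -sumrB => h hk.
have pos (j : 'I_(n - 3)) : true ->
  0 <= `|L2 j - L1 j| + `|L3 j - L2 j| - `|L3 j - L1 j| by lia.
have /psumr_eq0P : \sum_(j < n - 3)
    (`|L2 j - L1 j| + `|L3 j - L2 j| - `|L3 j - L1 j|) = 0.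
  by apply/le_anti; rewrite h sumr_ge0.
by move=> /(_ pos (Ordinal hk) isT) /= /eqP; rewrite subr_eq0 => /eqP.
Qed.

Definition reversal_distance := (n * (n - 3))./2.

Local Notation rdist := reversal_distance.

Hypothesis hn : (4 < n)%N.
Local Notation vertex := (zvertex hn).
Local Notation diag := (zdiag hn).
Local Notation chord := (path_chord hn).
Local Notation colored := (path_coloring hn).

Lemma eq_colored L L' : (forall k, (k < n - 3)%N -> L k = L' k) -> colored L = colored L'.
Proof. by move=> e; apply/ffunP => k; rewrite !ffunE /path_chord /top e. Qed.

(** A colored triangulation determines its lattice path up to the period n: the
    short chord of label 0 locates the path, and n > 4 is what tells its two
    endpoints apart. *)
Lemma colored_inj L L' : lattice_path L -> lattice_path L' -> colored L = colored L' ->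
  exists q, forall k, (k < n - 3)%N -> L' k = L k + q * n%:Z.
Proof.
move=> hL hL' e; have [q hq] := int_window hn (L 0%N) (L' 0%N).
exists (- q) => k hk; suff: L' k + q * n%:Z = L k by lia.
have ek j : (j < n - 3)%N -> diag (L j) (L j + j%:Z + 2) =
    diag (L' j + q * n%:Z) (L' j + q * n%:Z + j%:Z + 2).
  move=> hj; have := congr1 (fun C : coloring n => C (Ordinal hj)) e.
  rewrite !ffunE /path_chord /top /= => ->.
  by rewrite -(diag_shift hn _ _ q); congr diag; lia.
have n3 : (0 < n - 3)%N by lia.
have e0 : L' 0%N + q * n%:Z = L 0%N.
  have /eqP := ek _ n3; rewrite addr0 set2_eq addr0.
  case/orP => /andP[]; first by rewrite vertex_eq; lia.
  move=> + h; have {}h : L' 0%N + q * n%:Z = L 0%N + 2 by move: h; rewrite vertex_eq; lia.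
  by rewrite h vertex_eq; lia.
have := lattice_path_mono (j := 0%N) (k := k) hL; rewrite hk => /(_ isT) m.
have := lattice_path_mono (j := 0%N) (k := k) hL'; rewrite hk => /(_ isT) m'.
have /eqP := ek _ hk; rewrite set2_eq; case/orP => /andP[h1 h2].
  by move: h1; rewrite vertex_eq; lia.
(* the endpoints would be exchanged; both differences are positive and they sum
   to 2 k + 4 < 2 n, so one of them is not a multiple of n *)
have [d|d] : (L k + k%:Z + 2 - (L' k + q * n%:Z) < n%:Z \/
    (L' k + q * n%:Z + k%:Z + 2) - L k < n%:Z) by lia.
  by move: h2; rewrite vertex_eq; lia.
by move: h1; rewrite vertex_eq; lia.
Qed.

Lemma seg_diag i j : (i < n)%N -> (j < n)%N -> seg n i j = diag i%:Z j%:Z.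
Proof.
move=> hi hj; apply/setP => x; rewrite !inE -!val_eqE /=.
by rewrite !modz_small //; lia.
Qed.

Lemma star_colored : star n = colored origin.
Proof.
apply/ffunP => k; rewrite !ffunE seg_diag; [|have := ltn_ord k; lia..].
by congr diag; rewrite /top /origin; lia.
Qed.

Lemma reversal_star_colored : reversal (star n) = colored target.
Proof.
apply/ffunP => k; have hk := ltn_ord k; rewrite !ffunE seg_diag /=; [|lia..].
rewrite /path_chord diagC /zdiag -(vertexDn hn (0%N : int)).
by congr [set vertex _; vertex _]; rewrite /top /target; lia.
Qed.

Lemma Gamma_step L C : lattice_path L -> Gamma (colored L) C ->
  exists L', [/\ lattice_path L', C = colored L' & step L L'].
Proof.
move=> hL /and3P[_ CT /existsP[e ee]].
have [k hk] : exists k : 'I_(n - 3), forall j, j != k -> C j = colored L j.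
  by case/orP: ee => /flip_off[k [_ hk _]]; exists k => j /hk.
have [|L' [h1 h2 h3 h4]] := @recolor_path n hn _ _ _ hL (ltn_ord k) CT.
  by move=> j jk; rewrite hk ?ffunE //; apply: contra_not_neq jk => ->.
by exists L'; split=> //; exists k.
Qed.

(** Only the lift of the initial vertex has to be chosen; the others follow
    step by step. *)
Lemma walk_lift L p : lattice_path L -> path (@Gamma n) (colored L) p ->
  exists M : nat -> nat -> int, [/\ M 0%N = L,
    forall i, (i <= size p)%N -> lattice_path (M i) /\
      nth (star n) (colored L :: p) i = colored (M i) &
    forall i, (i < size p)%N -> step (M i) (M i.+1)].
Proof.
elim: p L => [|C p IH] L hL /=.
  by exists (fun=> L); split => // -[].
case/andP => /(Gamma_step hL)[L' [hL' -> st]] /(IH _ hL')[M [M0 Mp Mst]].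
exists (fun i => if i is i'.+1 then M i' else L); split => //.
  by case=> [|i] hi //=; apply: Mp.
by case=> [|i] hi; [rewrite M0|apply: Mst].
Qed.

Lemma sum_target : \sum_(k < n - 3) target k = rdist%:Z.
Proof.
have tri m : ((\sum_(k < m) (m.+1 - k)).*2 = (m + 3) * m)%N.
  elim: m => [|m IH]; first by rewrite big_ord0 muln0.
  rewrite big_ord_recl doubleD subn0.
  have -> : (\sum_(k < m) (m.+2 - lift ord0 k) = \sum_(k < m) (m.+1 - k))%N by [].
  by rewrite IH; lia.
have := tri (n - 3)%N; have -> : (n - 3 + 3 = n)%N by lia.
rewrite /reversal_distance => <-; rewrite doubleK.
rewrite -[RHS]natz natr_sum; apply: eq_bigr => k _.
by rewrite natz /target; have := ltn_ord k; lia.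
Qed.

(** For q < 0 the k-th distance is at least k + 2, and reversing the order of the
    labels turns k + 2 into n - 2 - k. *)
Lemma dist_target q : dist origin (fun k => target k + q * n%:Z) >=
  rdist%:Z + (if 0 <= q then q else 0).
Proof.
rewrite -sum_target; case: ifP => q0.
  have n3 : (0 < n - 3)%N by lia.
  rewrite /dist (bigD1 (Ordinal n3)) //= [X in _ <= X](bigD1 (Ordinal n3)) //=.
  rewrite addrAC lerD //; first by rewrite /target /origin; nia.
  by apply: ler_sum => k _; have := ltn_ord k; rewrite /target /origin; nia.
rewrite addr0 (reindex_inj rev_ord_inj) /=; apply: ler_sum => k _.
by have := ltn_ord k; rewrite /target /origin /=; nia.
Qed.

Lemma walk_to_target p : path (@Gamma n) (star n) p ->
  last (star n) p = reversal (star n) ->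
  exists M q, [/\ M 0%N = origin,
    forall i, (i <= size p)%N -> lattice_path (M i) /\
      nth (star n) (star n :: p) i = colored (M i),
    forall i, (i < size p)%N -> step (M i) (M i.+1) &
    forall k, (k < n - 3)%N -> M (size p) k = target k + q * n%:Z].
Proof.
move=> pp; rewrite (last_nth (star n)) reversal_star_colored.
move: pp; rewrite [X in path _ X]star_colored.
move=> /(walk_lift origin_path)[M [M0 Mp Mst]]; rewrite -star_colored in Mp.
have [hM ->] := Mp _ (leqnn _).
move=> /esym /(colored_inj target_path hM)[q Mq].
by exists M, q.
Qed.

Lemma walk_size p : path (@Gamma n) (star n) p ->
  last (star n) p = reversal (star n) -> (rdist <= size p)%N.
Proof.
move=> pp lp; have [M [q [M0 Mp Mst Mq]]] := walk_to_target pp lp.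
have := dist_walk (i := 0%N) (j := size p) (leqnn _) Mst.
have := dist_target q; rewrite M0 (eq_dist (fun _ _ => erefl) Mq) subn0.
by case: ifP => ? h1 h2; have := le_trans h1 h2; lia.
Qed.

Lemma Gamma_raise L L' (k : nat) : lattice_path L -> lattice_path L' -> (k < n - 3)%N ->
  L' k = L k + 1 -> (forall j, (j < n - 3)%N -> j <> k -> L' j = L j) ->
  Gamma (colored L) (colored L').
Proof.
move=> hL hL' hk e1 e2; apply/and3P; split; try exact: colored_CTFT.
by apply/existsP; exists (chord L k); rewrite (flip_raise hn hL hL' hk).
Qed.

(** Below the target there is always room to raise the path: among the heights
    that are still too low, one minimizing 2 L k + k has neighbours that let it
    grow. *)
Lemma walk_up m L : lattice_path L ->
  (forall k, (k < n - 3)%N -> 0 <= L k <= target k) ->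
  \sum_(k < n - 3) (target k - L k) = m%:Z ->
  exists p, [/\ path (@Gamma n) (colored L) p, last (colored L) p = colored target
    & size p = m].
Proof.
elim: m L => [|m IH] L hL hLt hm.
  exists [::]; split => //=; apply: eq_colored => k hk; apply/esym/eqP.
  rewrite -subr_eq0; move/psumr_eq0P: hm => /(_ _ (Ordinal hk) isT) /= -> // j _.
  by rewrite subr_ge0; have /andP[] := hLt j (ltn_ord j).
pose low := [pred k : 'I_(n - 3) | L k < target k].
have [k0 k0low] : exists k, low k.
  apply/existsP; apply: contraT => /existsPn no.
  suff : \sum_(k < n - 3) (target k - L k) = 0 by lia.
  rewrite big1 // => k _; have := no k; have := hLt k (ltn_ord k); rewrite /=; lia.
case: (@arg_minnP _ k0 low (fun k => `|(L k *+ 2 + (k : nat)%:Z)%R|%N) k0low).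
move=> k klow kmin; have hk := ltn_ord k; have hLk := hLt k hk.
have up : (k.+1 < n - 3)%N -> L k.+1 = L k.
  move=> hk1; have := hL k hk1; have := hLt _ hk1; have := kmin (Ordinal hk1).
  by move: klow; rewrite /= /target; lia.
have down : (0 < k)%N -> L k.-1 = L k + 1.
  move=> k_gt0; have hk1 : (k.-1 < n - 3)%N by lia.
  have kE : (k : nat) = k.-1.+1 by lia.
  have := hL k.-1; rewrite -kE => /(_ hk); have := hLt _ hk1; have := kmin (Ordinal hk1).
  by move: klow; rewrite /= /target; lia.
pose L' j : int := if j == k :> nat then L k + 1 else L j.
have L'k : L' k = L k + 1 by rewrite /L' eqxx.
have L'j (j : nat) : j <> k -> L' j = L j by move=> /eqP/negPf jk; rewrite /L' jk.
have hL' : lattice_path L'.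
  move=> j hj; have [jk|jk] := eqVneq j k.
    by rewrite jk in hj *; rewrite L'k L'j ?up //; lia.
  have [jk'|jk'] := eqVneq j.+1 k; last first.
    by rewrite !L'j; [exact: hL|exact/eqP..].
  rewrite jk' L'k L'j; last exact/eqP.
  by have := down; rewrite -jk' => /(_ isT) /= ->; lia.
have [||p [pp lp sp]] := IH L' hL'.
- move=> j hj; have [->|/eqP jk] := eqVneq j k; last by rewrite L'j //; apply: hLt.
  by rewrite L'k; move: klow hLk; rewrite /=; lia.
- move: hm; rewrite (bigD1 k) //= => hm; rewrite (bigD1 k) //= L'k.
  have eS : \sum_(j < n - 3 | j != k) (target j - L' j) =
      \sum_(j < n - 3 | j != k) (target j - L j).
    by apply: eq_bigr => j jk; rewrite L'j // => e; case/eqP: jk; apply: val_inj.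
  by rewrite eS; move: hm; set S := \sum_(_ | _) _; lia.
exists (colored L' :: p); rewrite /= sp lp; split => //.
by rewrite pp andbT; apply: Gamma_raise L'k _ => // j _; apply: L'j.
Qed.

Lemma shortest_walk : exists p, [/\ path (@Gamma n) (star n) p,
  last (star n) p = reversal (star n) & size p = rdist].
Proof.
rewrite reversal_star_colored star_colored; apply: walk_up => //.
  by move=> k hk; rewrite /origin /target; lia.
by rewrite -sum_target; apply: eq_bigr => k _; rewrite subr0.
Qed.

(** The lower bound walk_size is attained by shortest_walk, so shortness of a walk
    is a condition on its size alone. *)
Lemma geodesic_size p : geodesic (@Gamma n) (star n) (reversal (star n)) p =
  [&& path (@Gamma n) (star n) p, last (star n) p == reversal (star n)
    & size p == rdist].
Proof.
apply/and3P/and3P => -[pp /eqP lp]; rewrite lp pp eqxx.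
  move=> /forallP short; split => //; rewrite eqn_leq walk_size // andbT leqNgt.
  apply/negP => sp; have [w [pw lw sw]] := shortest_walk.
  have /forallP/(_ (Tuple (introT eqP sw))) := short (Ordinal sp).
  by rewrite /= pw lw eqxx.
move=> /eqP sp; split => //; apply/forallP => m; apply/forallP => w.
apply/negP => /andP[pw /eqP lw]; have := walk_size pw lw.
by rewrite size_tuple -sp leqNgt ltn_ord.
Qed.

End Walks.

(** * Geodesics starting with [0,2] are growths of lattice paths *)

Section Growths.

Variable n : nat.
Local Notation lattice_path := (lattice_path n).
Local Notation rdist := (reversal_distance n).

Definition raised (h h' : nat -> nat) k :=
  h' k = (h k).+1 /\ forall j, j < n - 3 -> j <> k -> h' j = h j.

(** H i k is the height at k after i steps; a growth is a saturated chain of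
    lattice paths from the origin to the target. *)
Definition growth (H : nat -> nat -> nat) :=
  [/\ forall k, k < n - 3 -> H 0 k = 0,
      forall k, k < n - 3 -> H rdist k = n - 2 - k,
      forall i, i <= rdist -> lattice_path (fun k => Posz (H i k)) &
      forall i, i < rdist -> exists2 k, k < n - 3 & raised (H i) (H i.+1) k].

Lemma growth_mono H i j k : growth H -> i <= j <= rdist -> k < n - 3 -> H i k <= H j k.
Proof.
case=> _ _ _ Hs + hk; elim: j => [|j IH] hij; first by have -> : i = 0 by lia.
have [->//|ij] : i = j.+1 \/ i <= j <= rdist by lia.
apply: leq_trans (IH ij) _; have [|l hl [e1 e2]] := Hs j; first by lia.
have [->|/eqP kl] := eqVneq k l; first by rewrite e1.
by rewrite e2.
Qed.

Lemma growth_bound H i k : growth H -> i <= rdist -> k < n - 3 -> H i k <= n - 2 - k.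
Proof.
move=> gH hi hk; have [_ Hd _ _] := gH; rewrite -Hd //.
by apply: growth_mono => //; rewrite hi leqnn.
Qed.

Hypothesis hn : 4 < n.
Local Notation diag := (zdiag hn).
Local Notation chord := (path_chord hn).
Local Notation colored := (path_coloring hn).

Definition growth_walk (H : nat -> nat -> nat) : seq (coloring n) :=
  mkseq (fun i => colored (fun k => Posz (H i.+1 k))) rdist.

Lemma nth_growth_walk H i : growth H -> i <= rdist ->
  nth (star n) (star n :: growth_walk H) i = colored (fun k => Posz (H i k)).
Proof.
case=> H0 _ _ _; case: i => [_|i hi] /=; last by rewrite nth_mkseq.
by rewrite (star_colored hn); apply: eq_colored => k hk; rewrite H0.
Qed.

Lemma growth_flip H i k : growth H -> i < rdist -> k < n - 3 ->
  raised (H i) (H i.+1) k ->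
  flipped_at (growth_walk H) i.+1 (seg n (H i k) (H i k + k + 2)).
Proof.
move=> gH hi hk [e1 e2]; have [_ _ Hl _] := gH.
have hb := growth_bound gH hi hk; rewrite e1 in hb.
rewrite /flipped_at !nth_growth_walk //=; last exact: ltnW.
rewrite (seg_diag hn); [|lia..].
have <- : chord (fun k => Posz (H i k)) k = diag (H i k) (H i k + k + 2)%N by [].
apply: flip_raise; [exact: (Hl _ (ltnW hi))|exact: Hl|by []| |].
  by rewrite e1; lia.
by move=> j hj jk; rewrite e2.
Qed.

(** A positive label could only be raised above its left neighbour. *)
Lemma growth_first H : growth H -> raised (H 0) (H 1) 0.
Proof.
case=> H0 _ Hl Hs; have d0 : 0 < rdist by rewrite /reversal_distance; nia.
have [k hk Hk] := Hs _ d0; have [k0|k0] := posnP k; first by rewrite k0 in Hk.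
have [e1 e2] := Hk; rewrite H0 // in e1.
have kE : k = k.-1.+1 by lia.
have := Hl 1 d0 k.-1; rewrite -kE => /(_ hk).
by rewrite e1 e2 ?H0; lia.
Qed.

Lemma growth_geodesic H : growth H ->
  geodesic (@Gamma n) (star n) (reversal (star n)) (growth_walk H) &&
  flipped_at (growth_walk H) 1 (seg n 0 2).
Proof.
move=> gH; have [H0 Hd Hl Hs] := gH.
have d0 : 0 < rdist by rewrite /reversal_distance; nia.
have n3 : 0 < n - 3 by lia.
apply/andP; split; last first.
  by have := growth_flip gH d0 n3 (growth_first gH); rewrite !H0.
rewrite (geodesic_size hn) size_mkseq eqxx andbT; apply/andP; split; last first.
  apply/eqP; rewrite (last_nth (star n)) size_mkseq nth_growth_walk //.
  rewrite (reversal_star_colored hn); apply: eq_colored => k hk.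
  by rewrite Hd // /target; lia.
apply/(pathP (star n)) => i; rewrite size_mkseq => hi.
rewrite -[nth _ (growth_walk H) i]/(nth (star n) (star n :: growth_walk H) i.+1).
rewrite !nth_growth_walk //; last exact: ltnW.
have [k hk [e1 e2]] := Hs i hi.
apply: Gamma_raise; [exact: (Hl _ (ltnW hi))|exact: Hl|exact: hk| |].
  by rewrite e1; lia.
by move=> j hj jk; rewrite e2.
Qed.

(** The heights of a growth lie between 0 and n - 2, which leaves no room for a
    translation by n. *)
Lemma eq_growth_walk H H' : growth H -> growth H' -> growth_walk H = growth_walk H' ->
  forall i k, i <= rdist -> k < n - 3 -> H i k = H' i k.
Proof.
move=> gH gH' e i k hi hk; have [_ _ Hl _] := gH; have [_ _ Hl' _] := gH'.
have := nth_growth_walk gH hi; rewrite e (nth_growth_walk gH' hi).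
case/(colored_inj (Hl' _ hi) (Hl _ hi)) => q hq.
have := hq k hk; have := growth_bound gH hi hk; have := growth_bound gH' hi hk.
have [->|q0] : q = 0%R \/ q <> 0%R by lia.
  by lia.
by nia.
Qed.

Local Open Scope ring_scope.

(** The walks that start by lowering the path end on a lower translate of the
    target; both kinds have the same length, and the first flip decides. *)
Lemma Dplus_growth p : geodesic (@Gamma n) (star n) (reversal (star n)) p ->
  flipped_at p 1 (seg n 0 2) -> exists2 H, growth H & p = growth_walk H.
Proof.
rewrite (geodesic_size hn) => /and3P[pp /eqP lp /eqP sp] fp.
have [M [q [M0 Mp Mst Mq]]] := walk_to_target hn pp lp; rewrite sp in Mp Mst Mq.
have d0 : (0 < rdist)%N by rewrite /reversal_distance; nia.
have n3 : (0 < n - 3)%N by lia.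
have [hM1 eM1] := Mp 1%N d0.
(* flipping [0,2] changes the height 0, and lowering it is not possible *)
have M1 : M 1%N 0%N = 1.
  have [k [hk hk1 hj]] := Mst 0%N d0; rewrite M0 /= in hk1 hj.
  have M10 : M 1%N 0%N <> 0.
    move: fp; rewrite /flipped_at eM1 /= => /flip_off[j [cj _]].
    have j0 : (j : nat) = 0%N.
      apply: (chord_inj (hn := hn) (@origin_path n) (ltn_ord j) n3).
      move: cj; rewrite (star_colored hn) ffunE => ->.
      by rewrite (seg_diag hn) //; lia.
    rewrite (seg_diag hn); [|lia..].
    rewrite -card_gt0 (diag_card hn) /=; [|lia..].
    move=> /(_ isT); rewrite ffunE j0 => /eqP h e; apply: h.
    by rewrite /path_chord /top e.
  have k0 : k = 0%N.
    by apply/eqP/negPn/negP => /eqP k0; apply: M10; rewrite hj // => e; exact: k0.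
  have h1 : (1 < n - 3)%N by lia.
  have := hM1 0%N h1; rewrite (hj 1%N) ?k0 // /origin.
  by move: hk1; rewrite k0 /origin; lia.
have up i : (i <= rdist)%N -> dist n origin (M i) <= i%:Z.
  by move=> hi; have := dist_walk (i := 0%N) (j := i) hi Mst; rewrite M0 subn0.
have down i : (i <= rdist)%N -> dist n (M i) (M rdist) <= (rdist - i)%N%:Z.
  by move=> hi; apply: dist_walk Mst; rewrite hi leqnn.
have far : rdist%:Z + (if 0 <= q then q else 0) <= dist n origin (M rdist).
  by rewrite (eq_dist (fun _ _ => erefl) Mq) (dist_target hn).
(* rdist steps are needed in total, so each lift lies on a shortest way *)
have between i k : (i <= rdist)%N -> (k < n - 3)%N ->
    `|M i k| + `|M rdist k - M i k| = `|M rdist k|.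
  move=> hi hk.
  have le : dist n origin (M i) + dist n (M i) (M rdist) <= dist n origin (M rdist).
    by have := up i hi; have := down i hi; move: far; case: ifP; lia.
  by have := dist_between le hk; rewrite /origin !subr0.
(* the height 0 has been raised, which rules out the lower translates *)
have q0 : q = 0.
  have := between 1%N 0%N d0 n3; rewrite M1 Mq // /target => b.
  have := up _ (leqnn _); move: far; case: ifP => // q0; first by lia.
  have q1 : q <= -1 by lia.
  by nia.
have {}Mq k : (k < n - 3)%N -> M rdist k = target n k by move=> hk; rewrite Mq ?q0; lia.
have Mpos i k : (i <= rdist)%N -> (k < n - 3)%N -> 0 <= M i k.
  by move=> hi hk; have := between i k hi hk; rewrite Mq // /target; lia.
pose H i k := `|M i k|%N.
have HM i k : (i <= rdist)%N -> (k < n - 3)%N -> (H i k)%:Z = M i k.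
  by move=> hi hk; have := Mpos i k hi hk; rewrite /H; lia.
have size_M i : (i <= rdist)%N -> dist n origin (M i) = i%:Z.
  move=> hi; have := dist_triangle n origin (M i) (M rdist).
  by have := up i hi; have := down i hi; move: far; case: ifP; lia.
exists H.
  split.
  - by move=> k hk; rewrite /H M0.
  - by move=> k hk; rewrite /H Mq // /target; lia.
  - move=> i hi k hk; have [hl _] := Mp i hi; rewrite !HM //; [exact: hl|exact: ltnW].
  - move=> i hi; have [k [hk hk1 hj]] := Mst i hi; exists k => //.
    split; last by move=> j _ /hj e; rewrite /H e.
    have := size_M _ (ltnW hi); have := size_M _ hi.
    rewrite /dist (bigD1 (Ordinal hk)) //= /origin subr0 => s1.
    rewrite (bigD1 (Ordinal hk)) //= subr0 => s2.
    have es : \sum_(j < n - 3 | j != Ordinal hk) `|M i.+1 j - 0| =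
        \sum_(j < n - 3 | j != Ordinal hk) `|M i j - 0|.
      apply: eq_bigr => j jk; rewrite hj // => ejk; case/eqP: jk; exact: val_inj.
    by move: s1 s2; rewrite es /H; set S := \sum_(_ < _ | _) _; lia.
rewrite -(mkseq_nth (star n) p) sp; apply/eq_in_map => i; rewrite mem_iota => hi.
have [_ e] := Mp i.+1 hi; rewrite -[LHS]/(nth (star n) (star n :: p) i.+1) e.
by apply: eq_colored => k hk; rewrite HM.
Qed.

End Growths.

(** * Growths and standard tableaux *)

(** Since f increases, the indices r with f r <= i form an initial segment, and
    the sum counts it. *)
Lemma sum_threshold (f : nat -> nat) t s i :
  (forall r, 1 <= r < t -> f r <= f r.+1) -> 1 <= s <= t ->
  (s <= \sum_(1 <= r < t.+1) (f r <= i)) = (f s <= i).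
Proof.
move=> fS /andP[s1 st].
have mono r r' : 1 <= r -> r <= r' <= t -> f r <= f r'.
  move=> r1; elim: r' => [|r' IH] hr; first by lia.
  have [->//|hr'] : r = r'.+1 \/ r <= r' <= t by lia.
  by apply: leq_trans (IH hr') (fS _ _); lia.
have one (m p : nat) : \sum_(m <= r < p) (f r <= i) <= p - m.
  rewrite -[leqRHS]muln1 -sum_nat_const_nat; apply: leq_sum => r _; exact: leq_b1.
have [h|h] := leqP (f s) i.
  rewrite (@big_cat_nat _ _ _ s.+1) //=.
  rewrite (eq_big_nat _ _ (F2 := fun=> 1)) => [|r hr]; last first.
    by rewrite (leq_trans (mono _ s _ _) h) //; lia.
  by rewrite sum_nat_const_nat; lia.
rewrite (@big_cat_nat _ _ _ s) //=; last by lia.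
rewrite [X in _ + X]big_nat_cond [X in _ + X]big1 => [|r hr]; last first.
  by have := mono s r s1; lia.
by have := one 1 s; lia.
Qed.

Section Tableaux.

Variable n : nat.
Local Notation rdist := (reversal_distance n).

(** The label of the chord whose flips are recorded in the cell: labels are the
    diagonals of the shape. *)
Definition label (x : cell n) : nat := col x - row x.

Lemma cell_bounds (x : cell n) : [/\ label x < n - 3, 1 <= row x,
  row x <= n - 2 - label x & col x = row x + label x].
Proof.
rewrite /label /row /col; case: x => [[r c] /= h].
by rewrite /in_shape in h; split; lia.
Qed.

Lemma cell_ext (x y : cell n) : row x = row y -> label x = label y -> x = y.
Proof.
have [_ _ _ ex] := cell_bounds x; have [_ _ _ ey] := cell_bounds y.
move=> er el; have ec : col x = col y by rewrite ex ey er el.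
apply: val_inj; rewrite [LHS]surjective_pairing [RHS]surjective_pairing.
by congr pair; apply: val_inj.
Qed.

Lemma cell_onto r k : k < n - 3 -> 1 <= r <= n - 2 - k ->
  exists x : cell n, row x = r /\ label x = k.
Proof.
move=> hk hr; have hrn : r < n by lia.
have hcn : r + k < n by lia.
have hs : in_shape n r (r + k) by rewrite /in_shape; lia.
exists (exist _ (Ordinal hrn, Ordinal hcn) hs).
by rewrite /label /row /col /=; lia.
Qed.

Hypothesis hn : 4 < n.

Section GrowthOfTableau.

Variables (Q : {ffun cell n -> nat}) (stQ : standard Q).

(** The tableau read by row and diagonal; the default 0 is taken outside the
    shape only. *)
Definition entry r k : nat := oapp Q 0 [pick x | (row x == r) && (label x == k)].

Lemma entryE x : entry (row x) (label x) = Q x.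
Proof.
rewrite /entry; case: pickP => [y /andP[/eqP e1 /eqP e2]|/(_ x)]; last by rewrite !eqxx.
by rewrite (cell_ext e1 e2).
Qed.

(** The number of cells of the diagonal k filled after i steps. *)
Definition growth_of i k : nat := \sum_(1 <= r < (n - 2 - k).+1) (entry r k <= i).

Lemma entry_row r k : k.+1 < n - 3 -> 1 <= r <= n - 2 - k.+1 -> entry r k < entry r k.+1.
Proof.
have /and3P[_ /forallP hrow _] := stQ => hk hr.
have [y [ry ly]] := cell_onto hk hr.
have [x [rx lx]] := @cell_onto r k (ltnW hk) ltac:(lia).
have := forallP (hrow x) y; rewrite -!entryE rx ry lx ly => /implyP; apply.
have [_ _ _ ->] := cell_bounds x; have [_ _ _ ->] := cell_bounds y.
by lia.
Qed.

Lemma entry_col r k : k < n - 3 -> 1 <= r < n - 2 - k -> k.+1 < n - 3 ->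
  entry r k.+1 < entry r.+1 k.
Proof.
have /and3P[_ _ /forallP hcol] := stQ => hk hr hk1.
have [y [ry ly]] := @cell_onto r.+1 k hk ltac:(lia).
have [x [rx lx]] := @cell_onto r k.+1 hk1 ltac:(lia).
have := forallP (hcol x) y; rewrite -!entryE rx ry lx ly => /implyP; apply.
have [_ _ _ ->] := cell_bounds x; have [_ _ _ ->] := cell_bounds y.
by lia.
Qed.

(** Diagonally adjacent cells are compared through the cell to the right of the
    first one. On the last diagonal that cell falls outside the truncated
    shape, and the cell below the first one is used; n > 4 makes it exist. *)
Lemma entry_diag r k : k < n - 3 -> 1 <= r < n - 2 - k -> entry r k < entry r.+1 k.
Proof.
move=> hk hr; have [hk1|hk1] := ltnP k.+1 (n - 3).
  by apply: ltn_trans (entry_row hk1 _) (entry_col hk hr hk1); lia.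
case: k => [|k] in hk hr hk1 *; first by lia.
by apply: ltn_trans (entry_col _ _ hk) (entry_row hk _); lia.
Qed.

Lemma growth_of_ge i k s : k < n - 3 -> 1 <= s <= n - 2 - k ->
  (s <= growth_of i k) = (entry s k <= i).
Proof.
move=> hk hs; apply: sum_threshold => // r hr.
by apply/ltnW/entry_diag.
Qed.

Lemma growth_of_le i k : growth_of i k <= n - 2 - k.
Proof.
apply: leq_trans (_ : \sum_(1 <= r < (n - 2 - k).+1) 1 <= _).
  by apply: leq_sum => r _; apply: leq_b1.
by rewrite sum_nat_const_nat muln1 subn1.
Qed.

Lemma mem_tableau v : (v \in codom Q) = (1 <= v <= rdist).
Proof.
have /and3P[/perm_mem -> _ _] := stQ.
by rewrite mem_iota add1n ltnS.
Qed.

Lemma entry_range r k : k < n - 3 -> 1 <= r <= n - 2 - k -> 1 <= entry r k <= rdist.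
Proof.
move=> hk hr; have [x [<- <-]] := cell_onto hk hr.
by rewrite entryE -mem_tableau codom_f.
Qed.

Lemma tableau_inj : injective Q.
Proof.
have /and3P[pQ _ _] := stQ; apply/injectiveP.
by rewrite /injectiveb /dinjectiveb -[map _ _]/(codom Q) (perm_uniq pQ) iota_uniq.
Qed.

(** The entry i + 1 is the next one on its diagonal, and it is in no other. *)
Lemma growth_of_step i x : Q x = i.+1 ->
  raised n (growth_of i) (growth_of i.+1) (label x) /\
  growth_of i (label x) = row x - 1.
Proof.
move=> Qx; have [lx r1 rt _] := cell_bounds x.
have rr : 1 <= row x <= n - 2 - label x by lia.
have ex : entry (row x) (label x) = i.+1 by rewrite entryE.
have h1 := growth_of_ge i.+1 lx rr; have h2 := growth_of_ge i lx rr.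
rewrite ex leqnn in h1; rewrite ex ltnn in h2.
have h3 : growth_of i.+1 (label x) <= row x.
  have [e|rlt] := eqVneq (row x) (n - 2 - label x); first by rewrite e growth_of_le.
  have hr' : 1 <= (row x).+1 <= n - 2 - label x by lia.
  have := @entry_diag (row x) _ lx; have := growth_of_ge i.+1 lx hr'; lia.
have h4 : row x - 1 <= growth_of i (label x).
  have [e|rgt] := eqVneq (row x) 1; first by rewrite e.
  have hr' : 1 <= row x - 1 <= n - 2 - label x by lia.
  have := @entry_diag (row x - 1) _ lx; have := growth_of_ge i lx hr'.
  have -> : (row x - 1).+1 = row x by lia.
  by lia.
split; last by lia.
split; first by lia.
move=> j hj jx; apply/eqP; rewrite eqn_leq; apply/andP; split; last first.
  by apply: leq_sum => r _; have [h|//] := leqP (entry r j) i; rewrite (leqW h).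
have [->//|s0] := posnP (growth_of i.+1 j).
have hs : 1 <= growth_of i.+1 j <= n - 2 - j by rewrite s0 growth_of_le.
rewrite (growth_of_ge _ hj hs); have := growth_of_ge i.+1 hj hs.
rewrite leqnn => /esym; rewrite leq_eqVlt => /orP[/eqP e|//].
have [y [ry ly]] := cell_onto hj hs; case: jx.
by rewrite -ly; congr label; apply: tableau_inj; rewrite -entryE ry ly e.
Qed.

Lemma growth_of_growth : growth n growth_of.
Proof.
split=> [k hk|k hk|i hi k hk|i hi].
- apply/eqP; rewrite -leqn0 leqNgt; apply/negP => h.
  have h1 : 1 <= 1 <= n - 2 - k by lia.
  by have := entry_range hk h1; rewrite (growth_of_ge _ hk h1) in h; lia.
- apply/eqP; rewrite eqn_leq growth_of_le.
  have ht : 1 <= n - 2 - k <= n - 2 - k by lia.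
  by rewrite (growth_of_ge _ hk ht); have /andP[] := entry_range hk ht.
- have hk' := ltnW hk; have b1 := growth_of_le i k; have b2 := growth_of_le i k.+1.
  have h1 : growth_of i k.+1 <= growth_of i k.
    have [->//|s0] := posnP (growth_of i k.+1).
    have hs : 1 <= growth_of i k.+1 <= n - 2 - k.+1 by rewrite s0.
    have hs' : 1 <= growth_of i k.+1 <= n - 2 - k by lia.
    rewrite (growth_of_ge _ hk' hs'); apply: leq_trans (ltnW (entry_row hk hs)) _.
    by rewrite -(growth_of_ge _ hk hs).
  have h2 : growth_of i k <= (growth_of i k.+1).+1.
    have [|s1] := leqP (growth_of i k) 1; first by lia.
    pose s := (growth_of i k).-1; have sE : growth_of i k = s.+1 by rewrite /s; lia.
    have hs : 1 <= s < n - 2 - k by lia.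
    have hs' : 1 <= s <= n - 2 - k.+1 by lia.
    have hs1 : 1 <= s.+1 <= n - 2 - k by lia.
    rewrite sE ltnS (growth_of_ge _ hk hs').
    apply: leq_trans (ltnW (entry_col hk' hs hk)) _.
    by rewrite -(growth_of_ge _ hk' hs1) -sE.
  by lia.
have /codomP[x Qx] : i.+1 \in codom Q by rewrite mem_tableau.
have [lx _ _ _] := cell_bounds x; exists (label x) => //.
by case: (growth_of_step (esym Qx)).
Qed.

End GrowthOfTableau.

Lemma growth_of_inj (Q Q' : {ffun cell n -> nat}) : standard Q -> standard Q' ->
  (forall i k, i <= rdist -> k < n - 3 -> growth_of Q i k = growth_of Q' i k) ->
  Q = Q'.
Proof.
move=> sQ sQ' e; apply/ffunP => x; have [lx r1 rt _] := cell_bounds x.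
have hr : 1 <= row x <= n - 2 - label x by rewrite r1.
have same i : i <= rdist -> (Q x <= i) = (Q' x <= i).
  by move=> hi; rewrite -!entryE -!growth_of_ge // e.
have := entry_range sQ lx hr; have := entry_range sQ' lx hr; rewrite !entryE.
move=> /andP[_ h'] /andP[_ h].
by apply/eqP; rewrite eqn_leq same // leqnn -same // leqnn.
Qed.

Section TableauOfGrowth.

Variables (H : nat -> nat -> nat) (gH : growth n H).

Lemma reaches (x : cell n) : exists i, row x <= H i (label x).
Proof.
have [_ Hd _ _] := gH; have [lx _ rt _] := cell_bounds x.
by exists rdist; rewrite Hd.
Qed.

(** Each cell records the step at which the height of its diagonal reaches its
    row. *)
Definition tableau_of : {ffun cell n -> nat} := [ffun x => ex_minn (reaches x)].

Lemma tableau_of_le x i : i <= rdist -> (tableau_of x <= i) = (row x <= H i (label x)).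
Proof.
move=> hi; have [lx _ _ _] := cell_bounds x.
rewrite ffunE; case: ex_minnP => m hm min; apply/idP/idP => [mi|]; last exact: min.
by apply: leq_trans hm _; apply: (growth_mono gH _ lx); rewrite mi.
Qed.

Lemma tableau_of_range x : 1 <= tableau_of x <= rdist.
Proof.
have [H0 Hd _ _] := gH; have [lx r1 rt _] := cell_bounds x.
by rewrite tableau_of_le // Hd // rt andbT ltnNge tableau_of_le // H0 // leqNgt r1.
Qed.

(** The label of x is the only one whose height changes at the step written in
    the cell x. *)
Lemma tableau_of_step x i : tableau_of x = i.+1 ->
  raised n (H i) (H i.+1) (label x) /\ H i.+1 (label x) = row x.
Proof.
move=> Tx; have [lx r1 rt _] := cell_bounds x.
have := tableau_of_range x; rewrite Tx => /andP[_ hi].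
have := tableau_of_le x hi; have := tableau_of_le x (ltnW hi).
rewrite Tx ltnn leqnn => h1 h2; have [_ _ _ /(_ i hi)[k hk [e1 e2]]] := gH.
have [kE|/eqP kx] := eqVneq (label x) k; last by have := e2 _ lx kx; lia.
by rewrite kE in h1 h2 *; split; [split|lia].
Qed.

(** It suffices to compare heights at the step written in y: the height at the
    label of x is not changed by that step, so it had reached its row before. *)
Lemma tableau_of_lt x y : label x <> label y ->
  (forall i, i <= rdist -> row y <= H i (label y) -> row x <= H i (label x)) ->
  tableau_of x < tableau_of y.
Proof.
move=> lxy le; have := tableau_of_range y; case Ty : (tableau_of y) => [//|i] /= hi.
have [[_ e] ry] := tableau_of_step Ty; have [lx _ _ _] := cell_bounds x.
by rewrite ltnS (tableau_of_le _ (ltnW hi)) -e // le // ry.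
Qed.

Lemma tableau_of_standard : standard tableau_of.
Proof.
have [_ _ Hl Hs] := gH; apply/and3P; split.
- apply: uniq_perm; rewrite ?iota_uniq //.
    rewrite map_inj_uniq ?enum_uniq // => x y exy.
    have := tableau_of_range x; case Tx : (tableau_of x) => [//|i] _.
    have Ty := Tx; rewrite exy in Ty.
    have [[ex ox] rx] := tableau_of_step Tx; have [[ey oy] ry] := tableau_of_step Ty.
    have [lx _ _ _] := cell_bounds x.
    have lxy : label x = label y.
      by apply/eqP/negPn/negP => /eqP /(oy _ lx); rewrite ex; lia.
    by apply: (cell_ext _ lxy); rewrite -rx -ry lxy.
  move=> i; rewrite mem_iota add1n ltnS; apply/codomP/idP => [[x ->]|hi].
    exact: tableau_of_range.
  case: i => [//|i] in hi *; have {}hi : i < rdist by [].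
  have [k hk [e1 e2]] := Hs i hi.
  have hr : 1 <= H i.+1 k <= n - 2 - k by rewrite (growth_bound gH) // e1.
  have [x [rx lx]] := cell_onto hk hr; exists x; apply/eqP; rewrite eqn_leq andbC.
  by rewrite tableau_of_le // lx rx leqnn ltnNge tableau_of_le ?(ltnW hi) // lx rx e1 ltnn.
- apply/forallP => x; apply/forallP => y; apply/implyP => /andP[/eqP rxy cxy].
  have [lx _ _ cx] := cell_bounds x; have [ly _ _ cy] := cell_bounds y.
  apply: tableau_of_lt => [|i hi]; first by lia.
  have hxy : label x <= label y < n - 3 by lia.
  by have := lattice_path_mono (Hl i hi) hxy; lia.
- apply/forallP => x; apply/forallP => y; apply/implyP => /andP[/eqP cxy rxy].
  have [lx _ _ cx] := cell_bounds x; have [ly _ _ cy] := cell_bounds y.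
  apply: tableau_of_lt => [|i hi]; first by lia.
  have hxy : label y <= label x < n - 3 by lia.
  by have := lattice_path_mono (Hl i hi) hxy; lia.
Qed.

Lemma tableau_ofK i k : i <= rdist -> k < n - 3 -> growth_of tableau_of i k = H i k.
Proof.
move=> hi hk; have b1 := growth_of_le tableau_of i k.
have b2 := growth_bound gH hi hk.
have same s : 1 <= s <= n - 2 - k -> (s <= growth_of tableau_of i k) = (s <= H i k).
  move=> hs; rewrite (growth_of_ge tableau_of_standard) //.
  by have [x [<- <-]] := cell_onto hk hs; rewrite entryE tableau_of_le.
apply/eqP; rewrite eqn_leq; apply/andP; split.
  by have [->//|h] := posnP (growth_of tableau_of i k); rewrite -same ?leqnn ?h.
by have [->//|h] := posnP (H i k); rewrite same ?leqnn ?h.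
Qed.

End TableauOfGrowth.

Definition walk_of (Q : tableau n) : seq (coloring n) :=
  growth_walk hn (growth_of (val Q)).

Lemma walk_of_growth (Q : tableau n) : growth n (growth_of (val Q)).
Proof. exact: growth_of_growth (valP Q). Qed.

Definition geodesic_of (Q : tableau n) : Dplus n :=
  exist _ (walk_of Q) (growth_geodesic hn (walk_of_growth Q)).

Lemma geodesic_of_inj : injective geodesic_of.
Proof.
move=> Q Q' /(congr1 sval) /= e; apply: val_inj.
apply: growth_of_inj (valP Q) (valP Q') _ => i k hi hk.
exact: eq_growth_walk (walk_of_growth Q) (walk_of_growth Q') e _ _ hi hk.
Qed.

Lemma geodesic_of_onto (u : Dplus n) : exists Q, sval (geodesic_of Q) == sval u.
Proof.
case: u => p /= /andP[gp fp]; have [H gH ->] := Dplus_growth hn gp fp.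
exists (exist _ (tableau_of gH) (tableau_of_standard gH)); apply/eqP.
apply/eq_in_map => i; rewrite mem_iota => hi; apply: eq_colored => k hk.
by rewrite tableau_ofK.
Qed.

(** At step i the height k = column - row rises from row - 1, so the flipped chord
    is [row - 1, row - 1 + k + 2]; it never wraps around, as column + 1 < n. *)
Lemma flipped_at_walk_of (Q : tableau n) i : 1 <= i <= rdist ->
  flipped_at (walk_of Q) i (seg n (row_of Q i - 1) (col_of Q i + 1)).
Proof.
rewrite -(mem_tableau (valP Q)) => Qi; have hi := Qi.
rewrite (mem_tableau (valP Q)) in hi.
rewrite /row_of /col_of; case: pickP => [x /eqP Qx /=|no]; last first.
  by case/codomP: Qi => x ex; have := no x; rewrite -ex eqxx.
case: i => [//|i] in hi Qi Qx *.
have [lx r1 _ cx] := cell_bounds x.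
have [up e] := growth_of_step (valP Q) Qx.
have := growth_flip hn (walk_of_growth Q) hi lx up; rewrite e.
by have -> : row x - 1 + label x + 2 = col x + 1 by lia.
Qed.

End Tableaux.

Theorem proposition9p7 (n : nat) (hn : 4 < n) :
  exists phi : Dplus n -> tableau n,
    bijective phi /\
    forall (u : Dplus n) (i : nat), 1 <= i <= (n * (n - 3))./2 ->
      flipped_at (sval u) i
        (seg n (row_of (phi u) i - 1) (col_of (phi u) i + 1)).
Proof.
pose phi u := xchoose (geodesic_of_onto hn u).
have phiK u : geodesic_of hn (phi u) = u.
  by apply: val_inj; apply/eqP; apply: (xchooseP (geodesic_of_onto hn u)).
exists phi; split=> [|u i hi].
  by exists (geodesic_of hn) => // Q; apply: geodesic_of_inj; rewrite phiK.
by rewrite -{1}(phiK u); apply: flipped_at_walk_of.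
Qed.
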